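(* Let $\mathcal{A}$ be a constant real $n\times n$ matrix and $\mathcal{C}$ a constant real $m\times n$ matrix such that the linear time-invariant system $\dot x=\mathcal{A}x,\ y=\mathcal{C}x$ is completely observable. Then there exists a constant $c$ such that for every bounded interval $I\subset\mathbb{R}$ of (positive) integer length, every integrable $f:I\to\mathbb{R}^n$, and every solution $z:I\to\mathbb{R}^n$ of $\dot z=\mathcal{A}z+f$ on $I$, $$\int_I|z|\,dt\leq c\left(\int_I|\mathcal{C}z|\,dt+\int_I|f|\,dt\right).$$ In particular, the constant $c$ does not depend on the interval $I$.
   Context: The system $\dot x=\mathcal{A}x,\ y=\mathcal{C}x$ (with $x(t)\in\mathbb{R}^n$ the state and $y(t)\in\mathbb{R}^m$ the observation) is called completely observable if the knowledge of the curve $y(t)$ in an open time interval allows one to recover $x(t)$ uniquely, i.e. two solutions $x$ of $\dot x=\mathcal{A}x$ with the same observation $y=\mathcal{C}x$ on a nonempty open time interval coincide. A solution $z$ of $\dot z=\mathcal{A}z+f$ is an absolutely continuous function (equivalently $z\in W^{1,1}$) satisfying the equation almost everywhere. $|\cdot|$ denotes the Euclidean norm. *)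

(* Defs.v *)
From HB Require Import structures.
From mathcomp Require Import all_boot all_order all_algebra.
From mathcomp Require Import all_classical all_reals all_analysis.

Set Implicit Arguments.
Unset Strict Implicit.
Unset Printing Implicit Defensive.

Import Order.TTheory GRing.Theory Num.Theory.
Import numFieldNormedType.Exports.

Local Open Scope classical_set_scope.
Local Open Scope ring_scope.

(* The library norm on matrices is the sup norm, hence this definition. *)
Definition enorm (R : realType) (n : nat) (v : 'cV[R]_n) : R :=
  Num.sqrt (\sum_(i < n) v i ord0 ^+ 2).

(* [lebesgue_measure] is restricted to Borel sets; its completion is used so
   that measurability means Lebesgue measurability. *)
Definition vintegrable (R : realType) (n : nat) (I : set R)
    (f : R -> 'cV[R]_n) : Prop :=
  forall i : 'I_n,
    completed_lebesgue_measure.-integrable I (fun t => (f t i ord0)%:E).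

Definition abs_continuous (R : realType) (n : nat) (I : set R)
    (z : R -> 'cV[R]_n) : Prop :=
  forall e : R, 0 < e -> exists2 d : R, 0 < d &
    forall (N : nat) (a b : 'I_N -> R),
      (forall k, [/\ I (a k), I (b k) & a k <= b k]) ->
      trivIset [set: 'I_N] (fun k => `]a k, b k[%classic) ->
      \sum_(k < N) (b k - a k) < d ->
      \sum_(k < N) enorm (z (b k) - z (a k)) < e.

(* Functions on an interval I are represented by total functions; their values
   outside I are irrelevant: the derivative at an interior point of I depends
   only on values in I, and the endpoints of I form a null set. *)
Definition forced_solution (R : realType) (n : nat) (A : 'M[R]_n) (I : set R)
    (f z : R -> 'cV[R]_n) : Prop :=
  abs_continuous I z /\
  {ae completed_lebesgue_measure, forall t : R, I t ->
      is_derive t 1 z (A *m z t + f t)}.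

Definition free_solution (R : realType) (n : nat) (A : 'M[R]_n)
    (x : R -> 'cV[R]_n) : Prop :=
  forall t : R, is_derive t 1 x (A *m x t).

Definition completely_observable (R : realType) (n m : nat)
    (A : 'M[R]_n) (C : 'M[R]_(m, n)) : Prop :=
  forall x1 x2 : R -> 'cV[R]_n,
    free_solution A x1 -> free_solution A x2 ->
  forall J : set R, open J -> is_interval J -> J !=set0 ->
    (forall t, J t -> C *m x1 t = C *m x2 t) ->
    forall t, x1 t = x2 t.

(* Main.v *)
(* Observability gives matrices [N j] with [1 = \sum_j N j *m (C *m A ^+ j)]
   (an unobservable vector would generate, by the matrix exponential, a nonzero
   free solution with zero observation).  Integrating by parts as for the
   identity [C A^j z = y^(j)] of the free system then yields polynomial
   matrices [K] and [L] and a polynomial [Psi] with values in [0, 1] such that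
   [K' + K A = L C + Psi A], [K 0 = 0] and [K s = 1].  Hence for a solution
   [z' = A z + f] on an interval [c, c + s],
     [z (c + s) = \int (L C z + Psi A z + K f)],
   which bounds [|z|] on that interval by the integrals of [|C z|] and [|f|] and
   by the integral of [|z|] times a constant that does not depend on [s].  For
   small [s] the last term is absorbed.  An interval of integer length is tiled
   by intervals of a fixed short length, which keeps the constant uniform. *)

Require Import Defs.
From mathcomp Require Import all_boot all_order all_algebra.
From mathcomp Require Import all_classical all_reals all_analysis.
From mathcomp Require Import measurable_realfun ring lra.

Set Implicit Arguments.
Unset Strict Implicit.
Unset Printing Implicit Defensive.

Import Order.TTheory GRing.Theory Num.Theory.
Import numFieldNormedType.Exports.

Local Open Scope classical_set_scope.
Local Open Scope ring_scope.

(** * Absolutely continuous functions and the fundamental theorem of calculus *)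

(** With a merely integrable forcing [f], the identity [C A^j z = y^(j)] fails and the higher
    derivatives of [C z] need not exist. Moving all derivatives onto polynomial weights leaves only
    integrals of [C z] and [f], at the price of needing the fundamental theorem of calculus for
    absolutely continuous functions. The absorption works because of an asymmetry. The bounds on [K]
    and [L] may depend on [s] in any way, since [s] is eventually fixed, whereas the coefficient of
    [|z|] must not. This is why [Psi] takes values in [0, 1]: that coefficient is then governed by
    the entries of [A] alone. Two mismatches remain. A solution is controlled on an interval that
    need not be closed, so closed windows are chosen inside open tiles. And [f] is only Lebesgue
    measurable, so the estimates are made for Borel functions and transferred to the completed
    measure at the end. *)

Definition acont (R : realType) (I : set R) (g : R -> R) : Prop :=
  forall e : R, 0 < e -> exists2 d : R, 0 < d &
    forall (N : nat) (a b : 'I_N -> R),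
      (forall k, [/\ I (a k), I (b k) & a k <= b k]) ->
      trivIset [set: 'I_N] (fun k => `]a k, b k[%classic) ->
      \sum_(k < N) (b k - a k) < d ->
      \sum_(k < N) `|g (b k) - g (a k)| < e.

Lemma lebesgue_measure_bigsetU_itv (R : realType) (N : nat) (a b : 'I_N -> R) :
  (forall k, a k <= b k) ->
  trivIset [set: 'I_N] (fun k => `]a k, b k[%classic) ->
  lebesgue_measure (\big[setU/set0]_(k < N) `]a k, b k[%classic) =
  (\sum_(k < N) (b k - a k))%:E.
Proof.
move=> ab tI.
have mab k : measurable (`]a k, b k[%classic : set R) by exact: measurable_itv.
rewrite -[LHS]mul1e -integral_cst ?ge0_integral_bigsetU//=; last 3 first.
- exact: index_enum_uniq.
- exact: sub_trivIset tI.
- exact: bigsetU_measurable.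
rewrite -sumEFin; apply: eq_bigr => k _.
rewrite integral_cst// mul1e [LHS]lebesgue_measure_itv /= lte_fin.
by case: ltgtP (ab k) => //= ->; rewrite subrr.
Qed.

Lemma sum_length_trivIset (R : realType) (N : nat) (a b : 'I_N -> R) (U : set R) :
  (forall k, a k <= b k) ->
  (forall k, `]a k, b k[ `<=` U) ->
  trivIset [set: 'I_N] (fun k => `]a k, b k[%classic) ->
  measurable U ->
  ((\sum_(k < N) (b k - a k))%:E <= lebesgue_measure U)%E.
Proof.
move=> ab abU tI mU; rewrite -lebesgue_measure_bigsetU_itv//.
apply: le_measure; rewrite ?inE//.
  by apply: bigsetU_measurable => // k _; exact: measurable_itv.
by rewrite -bigcup_seq => x [k _ /abU].
Qed.

(** An ordered list can be extended at its right end, which suits real induction better than a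
    family indexed by ordinals. The bound on total length becomes a bound on the measure of a set
    containing all the intervals. *)
Lemma acont_pairwise (R : realType) (I : set R) (g : R -> R) (e : R) :
  acont I g -> 0 < e -> exists2 d : R, 0 < d &
    forall (U : set R) (s : seq (R * R)), measurable U ->
      (lebesgue_measure U < d%:E)%E ->
      (forall p, p \in s ->
        [/\ I p.1, I p.2, p.1 <= p.2 & `]p.1, p.2[ `<=` U]) ->
      pairwise (fun p q => p.2 <= q.1) s ->
      \sum_(p <- s) `|g p.2 - g p.1| < e.
Proof.
move=> ag /ag[d d0 H]; exists d => // U s mU Ud sP ps.
rewrite (big_nth (0, 0)) big_mkord.
have sk (k : 'I_(size s)) : nth (0, 0) s k \in s by exact: mem_nth.
have tI : trivIset [set: 'I_(size s)]
    (fun k => `](nth (0, 0) s k).1, (nth (0, 0) s k).2[%classic).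
  move=> i j _ _ [x [/=]]; rewrite !in_itv/= => /andP[i1 i2] /andP[j1 j2].
  apply: val_inj => /=; case: (ltngtP i j) => // ij.
    have /(pairwiseP (0, 0))/(_ i j) := ps.
    rewrite !inE !ltn_ord => /(_ isT isT ij) h.
    by have := lt_trans (lt_le_trans i2 h) j1; rewrite ltxx.
  have /(pairwiseP (0, 0))/(_ j i) := ps.
  rewrite !inE !ltn_ord => /(_ isT isT ij) h.
  by have := lt_trans (lt_le_trans j2 h) i1; rewrite ltxx.
apply: (H _ (fun k => (nth (0, 0) s k).1) (fun k => (nth (0, 0) s k).2)) => //.
  by move=> k; have [] := sP _ (sk k).
rewrite -lte_fin; apply: le_lt_trans Ud; apply: sum_length_trivIset => //.
  by move=> k; have [] := sP _ (sk k).
by move=> k; have [] := sP _ (sk k).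
Qed.
Lemma is_derive0_dist (R : realType) (G : R -> R) (t e : R) :
  is_derive t 1 G 0 -> 0 < e ->
  exists2 r : R, 0 < r & forall y, `|y - t| < r -> `|G y - G t| <= e * `|y - t|.
Proof.
move=> [dG DG] e0; move/cvg_ex: dG => [l Gl].
have l0 : l = 0.
  by rewrite -DG; apply/esym/cvg_lim => //; exact: Rhausdorff.
move: Gl; rewrite l0 => /cvgrPdist_le /(_ e e0).
rewrite near_withinE => -[r /= r0 H].
exists r => // y yr.
have [->|yt] := eqVneq y t; first by rewrite !subrr normr0 mulr0.
have yt0 : y - t != 0 by rewrite subr_eq0.
have := H (y - t); rewrite /= sub0r normrN => /(_ yr yt0).
rewrite /GRing.scale /= mulr1 subrK sub0r normrN normrM normfV.
by rewrite ler_pdivrMl ?normr_gt0// mulrC.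
Qed.

(** Absolute continuity makes the variation of [G] over a small open neighbourhood of the
    exceptional null set negligible, and elsewhere the zero derivative makes it negligible. Real
    induction plays the part usually given to a Vitali covering. *)
Lemma acont_ae_derive0_const (R : realType) (a b : R) (G : R -> R) : a <= b ->
  acont `[a, b] G ->
  {ae lebesgue_measure, forall t, a < t < b -> is_derive t 1 G 0} ->
  G b = G a.
Proof.
move=> ab acG aeG; apply/eqP; rewrite -subr_eq0 -normr_le0.
apply/ler_addgt0Pr => e e0; rewrite add0r.
(* This slope contributes at most [e / 2] over the whole interval; the added 1 keeps the denominator
   positive when [a = b]. *)
pose c := e / (2 * (1 + (b - a))).
have ba0 : 0 < 1 + (b - a) by rewrite ltr_wpDr// subr_ge0.
have c0 : 0 < c by rewrite divr_gt0// mulr_gt0.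
have [d d0 Gd] := acont_pairwise acG (divr_gt0 e0 (ltr0Sn R 1)).
have [U [oU NU Ud]] : exists U, [/\ open U,
    (forall t, a <= t <= b -> ~ U t -> is_derive t 1 G 0) &
    (lebesgue_measure U < d%:E)%E].
  case: aeG => B [mB B0 BG].
  (* The hypothesis gives derivatives only in the interior, but the induction also visits [a] and
     [b], so both join the exceptional set. *)
  pose B' := B `|` [set a] `|` [set b].
  have mB' : measurable B' by do !apply: measurableU.
  have B'0 : lebesgue_measure B' = 0%E.
    apply/negligibleP => //; apply: negligibleU; [apply: negligibleU|].
    - exact/negligibleP.
    - by apply/negligibleP => //; exact: lebesgue_measure_set1.
    - by apply/negligibleP => //; exact: lebesgue_measure_set1.
  have [|U [oU BU UB]] := lebesgue_regularity_outer mB' _ d0.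
    by move: (ltry (0 : R)); rewrite -[X in (X < _)%E]B'0.
  exists U; split => //.
    move=> t tab nUt.
    apply: contrapT => nd; apply: nUt; apply: BU.
    have [ta|ta] := eqVneq t a; first by left; right.
    have [tb|tb] := eqVneq t b; first by right.
    left; left; apply: BG => /= h; apply: nd; apply: h.
    by move/andP: tab => [h1 h2]; rewrite !lt_neqAle eq_sym ta h1 tb h2.
  apply: le_lt_trans UB; have {1}-> : U = B' `|` (U `\` B') by rewrite setDUK.
  apply: le_trans (measureU2 _ _ _) _ => //.
    by apply: measurableD => //; exact: open_measurable.
  by rewrite [X in (X + _)%E]B'0 add0e.
(* Real induction on [x]: [`[a, x]] splits into intervals where the slope of [G]
   is at most [c] and disjoint intervals [s] inside the small open set [U]. *)
pose P x := a <= x <= b /\ exists s : seq (R * R),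
  [/\ forall p, p \in s -> [/\ a <= p.1, p.1 <= p.2, p.2 <= x & `]p.1, p.2[ `<=` U],
      pairwise (fun p q => p.2 <= q.1) s &
      `|G x - G a| <= c * (x - a) + \sum_(p <- s) `|G p.2 - G p.1| ].
(* Crossing [t]: if [t] is in [U], the interval from [x] to [y] is appended to the list; otherwise
   the derivative at [t] controls the increments from [x] to [t] and from [t] to [y]. *)
have step t : a <= t <= b -> exists2 r : R, 0 < r & forall x y, P x ->
    t - r < x -> x <= t -> t <= y -> y < t + r -> y <= b -> P y.
  move=> tab; have [tU|ntU] := pselect (U t).
    have /nbhs_ballP[r /= r0 rU] : nbhs t U by exact: open_nbhs_nbhs.
    exists r => // x y [/andP[ax xb] [s [sP ps Gx]]] trx xt ty ytr yb.
    have xy : x <= y := le_trans xt ty.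
    split; first by rewrite (le_trans ax xy).
    exists (rcons s (x, y)); split.
    - move=> p; rewrite mem_rcons in_cons => /predU1P[->|/sP[h1 h2 h3 h4]].
        split => //= u /=; rewrite in_itv/= => /andP[xu uy]; apply: rU.
        by rewrite /ball/= ltr_distl; apply/andP; split; lra.
      by split => //; exact: le_trans xy.
    - rewrite pairwise_rcons ps andbT; apply/allP => p /sP[_ _ + _] /=.
      by [].
    - rewrite big_rcons/= -[G y - G a](subrKA (G x)).
      rewrite (le_trans (ler_normD _ _))//.
      have : c * (x - a) <= c * (y - a) by rewrite ler_pM2l// lerD2r.
      by move: Gx; lra.
  have [r r0 H] := is_derive0_dist (NU _ tab ntU) c0.
  exists r => // x y [/andP[ax xb] [s [sP ps Gx]]] trx xt ty ytr yb.
  have xy : x <= y := le_trans xt ty.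
  split; first by rewrite (le_trans ax xy).
  exists s; split => //.
    by move=> p /sP[h1 h2 h3 h4]; split => //; exact: le_trans xy.
  have Hx : `|G t - G x| <= c * (t - x).
    have := H x; rewrite distrC (distrC (G x)) (ger0_norm (_ : 0 <= t - x)) ?subr_ge0//.
    by apply; lra.
  have Hy : `|G y - G t| <= c * (y - t).
    have := H y; rewrite (ger0_norm (_ : 0 <= y - t)) ?subr_ge0//.
    by apply; lra.
  have -> : G y - G a = (G y - G t) + (G t - G x) + (G x - G a) by ring.
  rewrite (le_trans (ler_normD _ _))// (le_trans (lerD (ler_normD _ _) Gx))//.
  have -> : c * (y - a) = c * (y - t) + c * (t - x) + c * (x - a) by ring.
  by move: Hx Hy; lra.
have Pa : P a.
  split; first by rewrite lexx.
  by exists [::]; split => //; rewrite !subrr normr0 mulr0 big_nil add0r.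
have Pub : ubound [set x | P x] b by move=> x [/andP[_ xb] _].
have supP : has_sup [set x | P x] by split; [exists a | exists b].
pose t := sup [set x | P x].
have tab : a <= t <= b.
  by apply/andP; split; [apply: ub_le_sup => //; case: supP|
    apply: ge_sup => //; case: supP].
have [r r0 H] := step _ tab.
have [x Px xt] := sup_adherent r0 supP.
have xlet : x <= t by apply: ub_le_sup => //; case: supP.
have Pb : P b.
  (* If [b] were not within reach of [t], the point [t + r / 2] would satisfy [P] beyond the
     supremum [t]. *)
  have [tb|bt] := ltP b (t + r / 2).
    apply: H Px _ _ _ _ _ => //; first by case/andP: tab.
    by lra.
  have Pt : P (t + r / 2).
    by apply: H Px _ _ _ _ _ => //; lra.
  have : t + r / 2 <= t by apply: ub_le_sup => //; case: supP.
  by move=> h; exfalso; move: h r0; lra.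
case: Pb => _ [s [sP ps Gb]].
have := Gd U s (open_measurable oU) Ud _ ps.
have h p : p \in s ->
     [/\ `[a, b]%classic p.1, `[a, b]%classic p.2, p.1 <= p.2
       & `]p.1, p.2[ `<=` U].
  move=> /sP[h1 h2 h3 h4]; split => //=; rewrite in_itv/=.
    by rewrite h1 (le_trans h2).
  by rewrite h3 (le_trans h1).
move=> /(_ h) hs.
have : c * (b - a) <= e / 2.
  rewrite /c -mulrA ler_pM2l// invfM -mulrA ler_piMr// ler_pdivrMl// mulr1.
  by rewrite lerDr.
by move: Gb hs; lra.
Qed.
Lemma acontS (R : realType) (I J : set R) (g : R -> R) :
  J `<=` I -> acont I g -> acont J g.
Proof.
move=> JI ag e /ag[d d0 H]; exists d => // N a b abJ.
by apply: H => k; have [/JI ? /JI ? ?] := abJ k.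
Qed.

Lemma acontD (R : realType) (I : set R) (f g : R -> R) :
  acont I f -> acont I g -> acont I (fun x => f x + g x).
Proof.
move=> af ag e e0; have e20 : 0 < e / 2 by rewrite divr_gt0.
have [d1 d10 H1] := af _ e20; have [d2 d20 H2] := ag _ e20.
exists (Num.min d1 d2); first by rewrite lt_min d10.
move=> N a b abI tI; rewrite lt_min => /andP[/(H1 _ _ _ abI tI) h1 /(H2 _ _ _ abI tI) h2].
rewrite [ltRHS]splitr; apply: le_lt_trans (ltrD h1 h2); rewrite -big_split/=.
by apply: ler_sum => k _; rewrite opprD addrACA; exact: ler_normD.
Qed.

Lemma acontN (R : realType) (I : set R) (f : R -> R) :
  acont I f -> acont I (fun x => - f x).
Proof.
move=> af e /af[d d0 H]; exists d => // N a b abI tI /(H _ _ _ abI tI).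
by congr (_ < _); apply: eq_bigr => k _; rewrite -opprD normrN.
Qed.

Lemma acontB (R : realType) (I : set R) (f g : R -> R) :
  acont I f -> acont I g -> acont I (fun x => f x - g x).
Proof. by move=> af ag; apply: acontD (acontN ag). Qed.

(** The integral of [|h|] over a set tends to 0 with the measure of the set; this is applied to the
    union of the given intervals. *)
Lemma acont_indefinite_integral (R : realType) (h : R -> R) :
  lebesgue_measure.-integrable setT (EFin \o h) ->
  acont setT (fun x => \int[lebesgue_measure]_(t in `]-oo, x]) h t).
Proof.
move=> ih e /(integral_normr_continuous ih)[d [d0 H]].
exists d => // N a b abI tI sd.
have ab k : a k <= b k by have [] := abI k.
have mab k : measurable (`]a k, b k[%classic : set (measurableTypeR R)).
  exact: measurable_itv.
pose D := \big[setU/set0]_(k < N) `]a k, b k[%classic.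
have mD : measurable D by exact: bigsetU_measurable.
have /H : (lebesgue_measure D < d%:E)%E.
  by rewrite lebesgue_measure_bigsetU_itv// lte_fin.
move=> /(_ mD); apply: le_lt_trans.
have ihS A : measurable A -> lebesgue_measure.-integrable A (EFin \o h).
  by move=> mA; apply: integrableS ih.
have inhS A : measurable A -> lebesgue_measure.-integrable A (EFin \o (fun x => `|h x|)).
  by move=> mA; apply: integrable_norm (ihS _ mA).
have -> : \int[lebesgue_measure]_(x in D) `|h x| =
    \sum_(k < N) \int[lebesgue_measure]_(x in `]a k, b k[) `|h x|.
  rewrite /Rintegral ge0_integral_bigsetU//=; last 3 first.
  - exact: index_enum_uniq.
  - exact: sub_trivIset tI.
  - by have /measurable_int := inhS _ mD.
  rewrite sum_fine//= => k _.
  exact: integrable_fin_num (inhS _ (mab k)).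
apply: ler_sum => k _.
have mi : measurable (`](a k), (b k)]%classic : set (measurableTypeR R)).
  exact: measurable_itv.
rewrite Rintegral_itvB//; last 2 first.
- by apply: ihS; exact: measurable_itv.
- by rewrite bnd_simp.
rewrite (le_trans (le_normr_Rintegral _ (ihS _ mi)))//.
by rewrite -Rintegral_itv_bndo_bndc//; exact: (inhS _ (mab k)).
Qed.

(** By Lebesgue differentiation, [g] minus an indefinite integral of [h] is absolutely continuous
    with zero derivative almost everywhere, hence takes equal values at [a] and [b]. *)
Lemma acont_FTC (R : realType) (a b : R) (g h : R -> R) : a <= b ->
  acont `[a, b] g ->
  {ae lebesgue_measure, forall t, a < t < b -> is_derive t 1 g (h t)} ->
  lebesgue_measure.-integrable `[a, b] (EFin \o h) ->
  \int[lebesgue_measure]_(t in `[a, b]) h t = g b - g a.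
Proof.
move=> ab acg aeg ih.
have mab : measurable (`[a, b]%classic : set (measurableTypeR R)).
  exact: measurable_itv.
pose h0 := h \_ `[a, b].
have ih0 : lebesgue_measure.-integrable setT (EFin \o h0).
  by have := (integrable_mkcond _ mab).1 ih; rewrite restrict_EFin.
pose F x := \int[lebesgue_measure]_(t in `]-oo, x]) h0 t.
have aF : acont `[a, b] F by apply: acontS (acont_indefinite_integral ih0).
have dF : {ae lebesgue_measure, forall x, derivable F x 1 /\ F^`()%classic x = h0 x}.
  apply: FTC1Ny; last exact: integrable_locally.
  by move=> y; apply: integrableS ih0 => //; exact: measurable_itv.
have := acont_ae_derive0_const ab (acontB acg aF).
have ae0 : {ae lebesgue_measure,
    forall t, a < t < b -> is_derive t 1 (fun x => g x - F x) 0}.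
  apply: filterS2 aeg dF; first exact: (ae_filter_ringOfSetsType lebesgue_measure).
  move=> t gt [dFt Ft] tab.
  have gt' := gt tab.
  have -> : 0 = h t - h0 t.
    rewrite /h0 patchE mem_set ?subrr//= in_itv/=.
    by case/andP: tab => /ltW-> /ltW->.
  have Ft' : is_derive t 1 F (h0 t).
    by split => //; rewrite -derive1E.
  exact: is_deriveB.
move=> /(_ ae0) E.
have -> : g b - g a = F b - F a by move: E; lra.
rewrite Rintegral_itvB//; last by apply: integrableS ih0 => //; exact: measurable_itv.
rewrite Rintegral_itv_obnd_cbnd.
  by apply: eq_Rintegral => x xab; rewrite /h0 patchE xab.
by apply: integrableS ih0 => //; exact: measurable_itv.
Qed.

(** * Kalman's condition *)

(** Multiplication by [A] enlarges the sum of absolute values of the coordinates by a factor of at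
    most [M]. The geometric bound lets an exponential series dominate the matrix exponential. *)
Lemma powmx_bound (R : realType) (n : nat) (A : 'M[R]_n) (v : 'cV[R]_n) :
  exists B M : R, [/\ 0 <= B, 0 <= M &
    forall k i, `|(A ^+ k *m v) i ord0| <= B * M ^+ k].
Proof.
pose M := \sum_i \sum_j `|A i j|; pose B := \sum_i `|v i ord0|.
have B0 : 0 <= B by apply: sumr_ge0.
have M0 : 0 <= M by apply: sumr_ge0 => i _; apply: sumr_ge0.
exists B, M; split => // k i.
suff H : \sum_i `|(A ^+ k *m v) i ord0| <= B * M ^+ k.
  by apply: le_trans H; rewrite (bigD1 i)//= lerDl sumr_ge0.
elim: k => [|k ih] {i}; first by rewrite expr0 mul1mx expr0 mulr1.
rewrite exprS -mulmxA exprS mulrCA; apply: le_trans (ler_wpM2l M0 ih).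
rewrite mulr_suml; apply: ler_sum => i _.
rewrite mxE (le_trans (ler_norm_sum _ _ _))// mulr_suml; apply: ler_sum => j _.
rewrite normrM ler_wpM2l// (bigD1 j)//= lerDl sumr_ge0//.
Qed.

(* Coefficients of [B exp(tA) v] as a power series in [t]. *)
Definition expmx_coeff (R : realType) (m n : nat) (B : 'M[R]_(m, n))
    (A : 'M[R]_n) (v : 'cV[R]_n) (i : 'I_m) (k : nat) : R :=
  (B *m (A ^+ k *m v)) i ord0 / k`!%:R.

Definition expmx_sol (R : realType) (n : nat) (A : 'M[R]_n) (v : 'cV[R]_n)
    (t : R) : 'cV[R]_n :=
  \col_i limn (pseries (expmx_coeff 1%:M A v i) t).

Lemma expmx_coeff_diffs (R : realType) (n : nat) (A : 'M[R]_n) (v : 'cV[R]_n) i :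
  pseries_diffs (expmx_coeff 1%:M A v i) = expmx_coeff 1%:M A (A *m v) i.
Proof.
apply/funext => k; rewrite /pseries_diffs /expmx_coeff exprSr -!mulmxA factS.
rewrite natrM invfM [in LHS](mulrC k.+1%:R^-1) mulrCA; congr (_ * _).
by rewrite mulrCA mulfV ?mulr1// pnatr_eq0.
Qed.

Lemma expmx_cvg (R : realType) (n : nat) (A : 'M[R]_n) (v : 'cV[R]_n) i t :
  cvgn (pseries (expmx_coeff 1%:M A v i) t).
Proof.
have [B [M [B0 M0 H]]] := powmx_bound A v.
apply: normed_cvg; apply: (@series_le_cvg _ _ (B *: exp_coeff (M * `|t|))).
- by move=> k /=.
- move=> k; rewrite /exp_coeff/=; apply: mulr_ge0 => //.
  by rewrite divr_ge0// exprn_ge0// mulr_ge0.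
- move=> k; rewrite /= /expmx_coeff mul1mx.
  have -> : (B *: exp_coeff (M * `|t|)) k =
      B * M ^+ k * (k`!%:R^-1 * `|t| ^+ k).
    transitivity (B * ((M * `|t|) ^+ k / k`!%:R)) => //.
    by rewrite exprMn -!mulrA [_^-1 * _]mulrC.
  rewrite normrM normrX normrM normfV normr_nat -mulrA.
  apply: ler_wpM2r (H k i); apply: mulr_ge0; last exact: exprn_ge0.
  by rewrite invr_ge0.
- by apply: is_cvg_seriesZ; exact: is_cvg_series_exp_coeff.
Qed.

(** Used twice: [B = A] identifies the derivative of the solution, and [B = C] its observation. *)
Lemma mulmx_expmx_sol (R : realType) (m n : nat) (B : 'M[R]_(m, n))
    (A : 'M[R]_n) (v : 'cV[R]_n) (t : R) i :
  (B *m expmx_sol A v t) i ord0 = limn (pseries (expmx_coeff B A v i) t).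
Proof.
apply/esym/cvg_lim; first exact: Rhausdorff.
rewrite mxE (_ : pseries _ _ =
    \sum_j (fun N => B i j * pseries (expmx_coeff 1%:M A v j) t N)).
  apply: (big_ind2 (fun (u : nat -> R) (x : R) => u @ \oo --> x)) => //.
  - exact: cvg_cst.
  - by move=> ? ? ? ? ? ?; exact: cvgD.
  - by move=> j _; rewrite mxE; apply: cvgMr; exact: expmx_cvg.
apply/funext => N; rewrite fct_sumE/= /pseries /series /=.
under [RHS]eq_bigr do rewrite mulr_sumr.
rewrite exchange_big/=; apply: eq_bigr => k _.
rewrite /expmx_coeff mxE mulr_suml mulr_suml; apply: eq_bigr => j _.
by rewrite mul1mx !mulrA.
Qed.

Lemma expmx_sol_free (R : realType) (n : nat) (A : 'M[R]_n) (v : 'cV[R]_n) :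
  free_solution A (expmx_sol A v).
Proof.
move=> t.
have dcoord i : is_derive t (1 : R) (fun s => expmx_sol A v s i ord0)
    ((A *m expmx_sol A v t) i ord0).
  rewrite mulmx_expmx_sol.
  have -> : (fun s => expmx_sol A v s i ord0) =
      fun s => limn (pseries (expmx_coeff 1%:M A v i) s).
    by apply/funext => s; rewrite mxE.
  have -> : expmx_coeff A A v i = pseries_diffs (expmx_coeff 1%:M A v i).
    rewrite expmx_coeff_diffs; apply/funext => k.
    rewrite /expmx_coeff mul1mx !mulmxA; congr ((_ *m v) _ _ / _).
    by rewrite -[LHS]/(A * A ^+ k) -exprS exprSr.
  (* Termwise differentiation at [t] asks for convergence at some point of larger absolute value;
     here the series converges everywhere. *)
  apply: (@pseries_snd_diffs _ _ (`|t| + 1)).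
  - exact: expmx_cvg.
  - by rewrite expmx_coeff_diffs; exact: expmx_cvg.
  - by rewrite !expmx_coeff_diffs; exact: expmx_cvg.
  - by rewrite [ltRHS]ger0_norm ?addr_ge0// ltrDl.
have D : derivable (expmx_sol A v) t 1.
  by apply/derivable_mxP => i j; rewrite ord1; have [] := dcoord i.
split => //; rewrite derive_mx//; apply/matrixP => i j; rewrite mxE ord1.
by have [_ ->] := dcoord i.
Qed.

Lemma expmx_sol0 (R : realType) (n : nat) (A : 'M[R]_n) (v : 'cV[R]_n) :
  expmx_sol A v 0 = v.
Proof.
apply/colP => i; rewrite mxE; apply: lim_near_cst => //.
near=> N; rewrite /pseries /series/=.
rewrite -[N]prednK; last by near: N.
rewrite big_nat_recl//= big1 ?addr0; last first.
  by move=> k _; rewrite expr0n mulr0.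
by rewrite /expmx_coeff mul1mx expr0 mul1mx divr1 mulr1.
Unshelve. all: by end_near. Qed.

(** All coefficients of the observation of [exp(tA) v] vanish, so observability identifies this
    solution with the zero one; time 0 then gives [v = 0]. *)
Lemma observable_ker0 (R : realType) (n m : nat) (A : 'M[R]_n)
    (C : 'M[R]_(m, n)) (v : 'cV[R]_n) :
  completely_observable A C -> (forall k, C *m (A ^+ k *m v) = 0) -> v = 0.
Proof.
move=> obs H.
have free0 : free_solution A (fun=> 0 : 'cV[R]_n).
  by move=> t; rewrite mulmx0; exact: is_derive_cst.
have := obs _ _ (expmx_sol_free A v) free0 setT openT.
have iT : is_interval [set: R] by [].
have nT : [set: R] !=set0 by exists 0.
move=> /(_ iT nT) h; rewrite -(expmx_sol0 A v); apply: h => t _.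
apply/colP => i; rewrite mulmx0 mulmx_expmx_sol mxE.
rewrite (_ : pseries _ _ = cst 0) ?lim_cst//.
apply/funext => N; rewrite /pseries /series/= big1// => k _.
by rewrite /expmx_coeff H mxE !mul0r.
Qed.

(** The row spaces of the stacked matrices [C A^j] grow with [J], and their ranks are at most [n].
    Taking [J] of maximal rank replaces an appeal to Cayley-Hamilton. *)
Lemma observable_left_inverse (R : realType) (n m : nat) (A : 'M[R]_n)
    (C : 'M[R]_(m, n)) : completely_observable A C ->
  exists J (N : 'I_J -> 'M[R]_(n, m)), 1%:M = \sum_(j < J) N j *m (C *m A ^+ j).
Proof.
move=> obs.
pose S J := (\sum_(j < J) <<C *m A ^+ j>>)%MS.
have [J maxJ] : exists J, forall J', (\rank (S J') <= \rank (S J))%N.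
  pose P r := `[< exists J, \rank (S J) = r >].
  have exP : exists r, P r by exists (\rank (S 0%N)); apply/asboolP; exists 0%N.
  have ubP r : P r -> (r <= n)%N by move=> /asboolP[J <-]; exact: rank_leq_col.
  case: (ex_maxnP exP ubP) => r /asboolP[J Jr] rmax; exists J => J'.
  by rewrite Jr; apply: rmax; apply/asboolP; exists J'.
have subJ j : (C *m A ^+ j <= S J)%MS.
  have SS : (S J <= S (maxn J j.+1))%MS.
    apply/sumsmx_subP => i _.
    have iJ : (i < maxn J j.+1)%N by rewrite leq_max ltn_ord.
    exact: (sumsmx_sup (Ordinal iJ)).
  have := mxrank_leqif_sup SS; move=> [le1 le2].
  have : (S (maxn J j.+1) <= S J)%MS by rewrite -le2 eqn_leq le1 maxJ.
  apply: submx_trans.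
  have jJ : (j < maxn J j.+1)%N by rewrite leq_max ltnSn orbT.
  by apply: (sumsmx_sup (Ordinal jJ)) => //; rewrite genmxE.
have : (1%:M <= S J)%MS.
  (* Each column of the cokernel of [S J] is annihilated by every [C A^k], hence vanishes, so [S J]
     is the full space. *)
  rewrite sub1mx -cokermx_eq0; apply/eqP/matrixP => i j.
  have /colP/(_ i) : col j (cokermx (S J)) = 0.
    apply: (observable_ker0 obs) => k.
    have /submxP[D CE] := subJ k.
    by rewrite mulmxA CE colE -mulmxA [X in D *m X]mulmxA mulmx_coker mul0mx mulmx0.
  by rewrite !mxE.
move=> /sub_sumsmxP[u uE].
(* The pseudo-inverse rewrites the square generators of the row spaces as multiples of the matrices
   [C A^j] themselves. *)
exists J, (fun j => u j *m (<<C *m A ^+ j>>%MS *m pinvmx (C *m A ^+ j))).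
rewrite uE; apply: eq_bigr => j _.
by rewrite -mulmxA mulmxKpV// genmxE.
Qed.

(** * Polynomial kernels *)

Lemma map_derivD (R : comNzRingType) (m n : nat) (K L : 'M[{poly R}]_(m, n)) :
  map_mx (@deriv R) (K + L) = map_mx (@deriv R) K + map_mx (@deriv R) L.
Proof. by apply/matrixP => i j; rewrite !mxE derivD. Qed.

Lemma map_derivZ (R : comNzRingType) (m n : nat) (p : {poly R}) (N : 'M[R]_(m, n)) :
  map_mx (@deriv R) (p *: map_mx polyC N) = p^`() *: map_mx polyC N.
Proof. by apply/matrixP => i j; rewrite !mxE derivM derivC mulr0 addr0. Qed.

(** Repeated integration by parts in algebraic form: along a solution, the last two terms amount to
    minus the derivative of [q K z], plus [q K f]. Each step lowers the power of [A] by one and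
    costs one factor [q] of the weight. The factor [q] kept in front of [K] makes boundary terms
    vanish at the zeros of [q]. *)
Lemma kalman_poly_step (R : comNzRingType) (n m : nat) (A : 'M[R]_n)
    (C : 'M[R]_(m, n)) (N : 'M[R]_(n, m)) (q : {poly R}) (j : nat) (p : {poly R}) :
  exists (K : 'M[{poly R}]_n) (L : 'M[{poly R}]_(n, m)),
    (q ^+ j * p) *: map_mx polyC (N *m (C *m A ^+ j)) =
    L *m map_mx polyC C - map_mx (@deriv R) (q *: K)
      - (q *: K) *m map_mx polyC A.
Proof.
elim: j p => [|j ih] p.
  exists 0, (p *: map_mx polyC N).
  rewrite expr0 mul1r mulmx1 map_mxM scaler0 mul0mx subr0 -scalemxAl.
  suff -> : map_mx (@deriv R) (0 : 'M[{poly R}]_n) = 0 by rewrite subr0.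
  by apply/matrixP => i k; rewrite !mxE deriv0.
(* Differentiating the weight leaves a multiple of [q ^+ j], which is the form required by the
   induction hypothesis. *)
pose P2 := (q ^+ j.+1 * p)^`().
have [p2 p2E] : exists p2, P2 = q ^+ j * p2.
  exists (q^`() * p *+ j.+1 + q * p^`()).
  rewrite /P2 derivM deriv_exp /= mulrDr mulrnAl mulrnAr; congr (_ *+ _ + _).
    by rewrite -mulrA mulrCA.
  by rewrite exprSr mulrA.
have [K [L E]] := ih p2.
pose M := map_mx polyC (N *m (C *m A ^+ j)).
exists (- K - (q ^+ j * p) *: M), (- L).
have qE : q *: (- K - (q ^+ j * p) *: M) = - (q *: K + (q ^+ j.+1 * p) *: M).
  by rewrite scalerBr scalerA mulrA -exprS scalerN opprD.
have dN (X : 'M[{poly R}]_n) : map_mx (@deriv R) (- X) = - map_mx (@deriv R) X.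
  by apply/matrixP => i k; rewrite !mxE derivN.
rewrite qE dN map_derivD map_derivZ -/P2 p2E E.
have -> : map_mx polyC (N *m (C *m A ^+ j.+1)) = M *m map_mx polyC A.
  by rewrite /M -map_mxM exprSr -!mulmxA.
rewrite !mulNmx mulmxDl !opprK scalemxAl.
move: (L *m _) (map_mx _ (q *: K)) (q *: K *m _) (_ *: M *m _) => a b c d.
by apply/matrixP => i k; rewrite !mxE; ring.
Qed.

Lemma kalman_poly (R : comNzRingType) (n m : nat) (A : 'M[R]_n)
    (C : 'M[R]_(m, n)) (J : nat) (N : 'I_J -> 'M[R]_(n, m)) (q : {poly R}) :
  1%:M = \sum_(j < J) N j *m (C *m A ^+ j) ->
  exists (K : 'M[{poly R}]_n) (L : 'M[{poly R}]_(n, m)),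
    (q ^+ J)%:M = L *m map_mx polyC C - map_mx (@deriv R) (q *: K)
      - (q *: K) *m map_mx polyC A.
Proof.
move=> NE.
(* The cofactor [q ^+ (J - j)] gives all summands the common weight [q ^+ J]. *)
have /fin_all_exists[K /fin_all_exists[L KL]] : forall j : 'I_J, exists K L, _ :=
  fun j => kalman_poly_step A C (N j) q j (q ^+ (J - j)).
exists (\sum_j K j), (\sum_j L j).
have -> : (q ^+ J)%:M = q ^+ J *: map_mx polyC (1%:M : 'M[R]_n).
  by rewrite map_scalar_mx scale_scalar_mx mulr1.
rewrite NE.
have -> : map_mx polyC (\sum_(j < J) N j *m (C *m A ^+ j)) =
    \sum_(j < J) map_mx polyC (N j *m (C *m A ^+ j)).
  by rewrite raddf_sum.
rewrite !scaler_sumr.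
have -> : map_mx (@deriv R) (\sum_j q *: K j) =
    \sum_j map_mx (@deriv R) (q *: K j).
  by apply: (big_morph _ (@map_derivD _ _ _)); apply/matrixP => i k; rewrite !mxE deriv0.
rewrite !mulmx_suml -!sumrB; apply: eq_bigr => j _.
by rewrite -KL -exprD subnKC// ltnW.
Qed.

(* [Psi = 1 - (1 - u ^ (J+1)) ^ (J+1)] with [u = X / s] increases from 0 to 1
   on [0, s] and its derivative is a multiple of [q ^ J] for
   [q = u (1 - u ^ (J+1))], which vanishes at 0 and at s. *)
Lemma kalman_kernel (R : realFieldType) (n m : nat) (A : 'M[R]_n)
    (C : 'M[R]_(m, n)) (J : nat) (N : 'I_J -> 'M[R]_(n, m)) (s : R) : 0 < s ->
  1%:M = \sum_(j < J) N j *m (C *m A ^+ j) ->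
  exists (K : 'M[{poly R}]_n) (L : 'M[{poly R}]_(n, m)) (Psi : {poly R}),
    [/\ map_mx (@deriv R) K + K *m map_mx polyC A =
          L *m map_mx polyC C + Psi *: map_mx polyC A,
        forall i j, (K i j).[0] = 0,
        forall i j, (K i j).[s] = (i == j)%:R &
        forall t, 0 <= t <= s -> 0 <= Psi.[t] <= 1].
Proof.
move=> s0 NE.
pose u : {poly R} := s^-1 *: 'X; pose w := 1 - u ^+ J.+1.
pose q := u * w; pose Psi := 1 - w ^+ J.+1.
have uE t : u.[t] = t / s by rewrite !hornerE mulrC.
have wE t : w.[t] = 1 - (t / s) ^+ J.+1 by rewrite !(hornerE, horner_exp) mulrC.
have PsiE t : Psi.[t] = 1 - (1 - (t / s) ^+ J.+1) ^+ J.+1.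
  by rewrite !(hornerE, horner_exp) mulrC.
(* The chain rule in [Psi] produces [J + 1] twice and [s^-1] once. *)
pose c : R := s^-1 *+ J.+1 *+ J.+1.
have dPsi : Psi^`() = c *: q ^+ J.
  rewrite /Psi derivB derivC sub0r deriv_exp /w derivB derivC sub0r deriv_exp /=.
  rewrite /u derivZ derivX -/u -/w /q exprMn /c.
  by rewrite mulNr mulNrn opprK mulrnAl -!scalerAl mul1r !scalerMnl.
have [K [L KL]] := kalman_poly q NE.
have q0 : q.[0] = 0 by rewrite hornerM uE mul0r mul0r.
have qs : q.[s] = 0 by rewrite hornerM wE divff ?gt_eqF// expr1n subrr mulr0.
(* The derivative of [Psi%:M] cancels the term [c q ^+ J] coming from [KL]. Since [q] vanishes at 0
   and [s], the boundary values of the kernel are those of [Psi]. *)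
exists (c%:P *: (q *: K) + Psi%:M), (c%:P *: L), Psi; split.
- rewrite map_derivD mulmxDl -!scalemxAl mul_scalar_mx.
  have -> : map_mx (@deriv R) (c%:P *: (q *: K)) = c%:P *: map_mx (@deriv R) (q *: K).
    by apply/matrixP => i j; rewrite !mxE derivM derivC mul0r add0r.
  have -> : map_mx (@deriv R) (Psi%:M : 'M[{poly R}]_n) = c%:P *: (q ^+ J)%:M.
    apply/matrixP => i j; rewrite !mxE; case: (i == j).
      by rewrite !mulr1n dPsi mul_polyC.
    by rewrite !mulr0n deriv0 mulr0.
  rewrite KL -!scalemxAl.
  move: (L *m _) (map_mx _ (q *: K)) (q *: (K *m _)) (Psi *: _) => a b d e.
  by apply/matrixP => i j; rewrite !mxE; ring.
- move=> i j; rewrite !mxE hornerD hornerM [in X in X + _]hornerM q0 mul0r mulr0 add0r.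
  by case: (i == j); rewrite ?mulr1n ?mulr0n ?horner0// PsiE mul0r expr0n subr0 expr1n subrr.
- move=> i j; rewrite !mxE hornerD hornerM [in X in X + _]hornerM qs mul0r mulr0 add0r.
  case: (i == j); rewrite ?mulr1n ?mulr0n ?horner0// PsiE divff ?gt_eqF//.
  by rewrite expr1n subrr expr0n subr0.
- move=> t /andP[t0 ts]; rewrite PsiE.
  have ts0 : 0 <= t / s by rewrite divr_ge0// ltW.
  have ts1 : t / s <= 1 by rewrite ler_pdivrMr// mul1r.
  have v0 : 0 <= 1 - (t / s) ^+ J.+1 by rewrite subr_ge0 exprn_ile1.
  have v1 : 1 - (t / s) ^+ J.+1 <= 1 by rewrite gerBl exprn_ge0.
  by rewrite subr_ge0 exprn_ile1//= gerBl exprn_ge0.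
Qed.

(** * Estimates on short intervals *)

Lemma acont_cst (R : realType) (I : set R) (c : R) : acont I (fun=> c).
Proof.
move=> e e0; exists 1 => // N a b _ _ _.
by rewrite big1// => k _; rewrite subrr normr0.
Qed.

Lemma acont_id (R : realType) (I : set R) : acont I id.
Proof.
move=> e e0; exists e => // N a b abI _; apply: le_lt_trans.
by apply: ler_sum => k _; have [_ _ h] := abI k; rewrite ger0_norm ?subr_ge0.
Qed.

Lemma acont_sum (R : realType) (I : set R) (n : nat) (f : 'I_n -> R -> R) :
  (forall i, acont I (f i)) -> acont I (fun x => \sum_i f i x).
Proof.
move=> af; rewrite (_ : (fun x => _) = \sum_i f i); last first.
  by apply/funext => x; rewrite fct_sumE.
apply: big_ind => //; first exact: acont_cst.
by move=> g h ag ah; exact: acontD ag ah.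
Qed.

Lemma acont_continuous (R : realType) (I : set R) (f : R -> R) :
  acont I f -> {within I, continuous f}.
Proof.
move=> af; apply/subspace_continuousP => x Ix.
apply/cvgrPdist_lt => e /af[d d0 H].
rewrite near_withinE; near=> y => Iy.
have xyd : `|x - y| < d by near: y; exact: (nbhsx_ballx x d d0).
have tI (a b : R) : trivIset [set: 'I_1] (fun=> `]a, b[%classic).
  by move=> i j _ _ _; rewrite !ord1.
have [xy|/ltW yx] := leP x y.
  have := H 1%N (fun=> x) (fun=> y) (fun=> And3 Ix Iy xy) (tI _ _).
  by rewrite !big_ord1 distrC; apply; rewrite -(ger0_norm (_ : 0 <= y - x)) ?subr_ge0// distrC.
have := H 1%N (fun=> y) (fun=> x) (fun=> And3 Iy Ix yx) (tI _ _).
by rewrite !big_ord1; apply; rewrite -(ger0_norm (_ : 0 <= x - y)) ?subr_ge0.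
Unshelve. all: by end_near. Qed.

Lemma acont_bounded (R : realType) (a b : R) (f : R -> R) : acont `[a, b] f ->
  exists2 M : R, 0 <= M & forall t, a <= t <= b -> `|f t| <= M.
Proof.
move=> /acont_continuous cf.
have /compact_bounded[M [_ HM]] := continuous_compact cf (@segment_compact _ a b).
exists (`|M| + 1); first by rewrite addr_ge0.
move=> t tab; apply: (HM (`|M| + 1)) => /=.
  by rewrite (le_lt_trans (ler_norm _))// ltrDl.
by exists t => //=; rewrite in_itv.
Qed.

Lemma acontM (R : realType) (a b : R) (f g : R -> R) :
  acont `[a, b] f -> acont `[a, b] g -> acont `[a, b] (fun x => f x * g x).
Proof.
move=> af ag; have [M M0 fM] := acont_bounded af; have [N N0 gN] := acont_bounded ag.
move=> e e0; pose e' := e / (M + N + 1).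
have MN0 : 0 < M + N + 1 by rewrite ltr_wpDl// addr_ge0.
have e'0 : 0 < e' by rewrite divr_gt0.
have [d1 d10 H1] := af _ e'0; have [d2 d20 H2] := ag _ e'0.
exists (Num.min d1 d2); first by rewrite lt_min d10.
move=> k u v uvI tI; rewrite lt_min => /andP[/(H1 _ _ _ uvI tI) h1 /(H2 _ _ _ uvI tI) h2].
pose S1 := \sum_(j < k) `|f (v j) - f (u j)|.
pose S2 := \sum_(j < k) `|g (v j) - g (u j)|.
apply: (@le_lt_trans _ _ (N * S1 + M * S2)).
  rewrite !mulr_sumr -big_split/=; apply: ler_sum => j _.
  have [uI vI _] := uvI j.
  have -> : f (v j) * g (v j) - f (u j) * g (u j) =
    g (v j) * (f (v j) - f (u j)) + f (u j) * (g (v j) - g (u j)) by ring.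
  apply: le_trans (ler_normD _ _) _; rewrite !normrM.
  by apply: lerD; apply: ler_wpM2r => //; [apply: gN|apply: fM].
have -> : e = e' * (M + N + 1) by rewrite mulfVK// gt_eqF.
rewrite -/S1 in h1; rewrite -/S2 in h2.
have : N * S1 <= N * e' by rewrite ler_wpM2l// ltW.
have : M * S2 <= M * e' by rewrite ler_wpM2l// ltW.
by move: e'0; lra.
Qed.

Lemma acont_horner (R : realType) (a b : R) (p : {poly R}) (f : R -> R) :
  acont `[a, b] f -> acont `[a, b] (fun x => p.[f x]).
Proof.
move=> af; elim/poly_ind: p => [|p c ih].
  rewrite (_ : (fun x => _) = (fun=> 0)); first exact: acont_cst.
  by apply/funext => x; rewrite horner0.
rewrite (_ : (fun x => _) = (fun x => p.[f x] * f x + c)).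
  by apply: acontD; [exact: acontM|exact: acont_cst].
by apply/funext => x; rewrite hornerMXaddC.
Qed.

Lemma acont_integrable (R : realType) (a b : R) (f : R -> R) :
  acont `[a, b] f -> lebesgue_measure.-integrable `[a, b] (EFin \o f).
Proof.
move=> /acont_continuous cf; apply: continuous_compact_integrable => //.
exact: segment_compact.
Qed.

Lemma acont_measurable (R : realType) (a b : R) (f : R -> R) :
  acont `[a, b] f -> measurable_fun (`[a, b] : set (measurableTypeR R)) f.
Proof.
by move=> /acont_integrable/measurable_int/measurable_EFinP.
Qed.

Lemma acontM_integrable (R : realType) (a b : R) (f g : R -> R) :
  acont `[a, b] f -> lebesgue_measure.-integrable `[a, b] (EFin \o g) ->
  lebesgue_measure.-integrable `[a, b] (EFin \o (fun x => f x * g x)).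
Proof.
move=> af ig.
apply: (@integrableMr _ _ _ (@lebesgue_measure R) _ _ f (EFin \o g)) => //.
  exact: acont_measurable.
have [M M0 fM] := acont_bounded af; exists M; split; first exact: num_real.
move=> x Mx y /=; rewrite in_itv/= => /fM h; exact: le_trans (ltW Mx).
Qed.

Lemma is_derive_horner_shift (R : realType) (p : {poly R}) (c t : R) :
  is_derive t (1 : R) (fun x => p.[x - c]) (p^`()).[t - c].
Proof.
pose p' := p \Po ('X - c%:P).
have -> : (fun x => p.[x - c]) = horner p'.
  by apply/funext => x; rewrite horner_comp !hornerE.
have -> : (p^`()).[t - c] = (p'^`()).[t].
  by rewrite deriv_comp derivXsubC mulr1 horner_comp !hornerE.
exact: is_derive_poly.
Qed.

Lemma is_derive_mx_coord (R : realType) (n : nat) (z : R -> 'cV[R]_n)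
    (w : 'cV[R]_n) (t : R) (i : 'I_n) :
  is_derive t 1 z w -> is_derive t (1 : R) (fun x => z x i ord0) (w i ord0).
Proof.
move=> [dz zw]; have := dz => /derivable_mxP/(_ i ord0) dzi.
by split => //; rewrite -zw derive_mx// mxE.
Qed.

Lemma is_derive_mulmx (R : realType) (m n : nat) (K : 'M[{poly R}]_(m, n))
    (z : R -> 'cV[R]_n) (w : 'cV[R]_n) (c t : R) (i : 'I_m) :
  is_derive t 1 z w ->
  is_derive t (1 : R) (fun x => \sum_j (K i j).[x - c] * z x j ord0)
    (\sum_j ((K i j)^`().[t - c] * z t j ord0 + (K i j).[t - c] * w j ord0)).
Proof.
move=> zw.
rewrite (_ : (fun x => _) = \sum_j (fun x => (K i j).[x - c] * z x j ord0)).
  apply: is_derive_sum => j.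
  have := is_deriveM (is_derive_horner_shift (K i j) c t) (is_derive_mx_coord j zw).
  by rewrite /GRing.scale/= addrC [X in X + _]mulrC.
by apply/funext => x; rewrite fct_sumE.
Qed.

(** This norm suits estimates made coordinate by coordinate; it is exchanged for the Euclidean norm
    only at the end. *)
Definition l1norm (R : realType) (n : nat) (v : 'cV[R]_n) : R :=
  \sum_i `|v i ord0|.

Lemma l1norm_ge0 (R : realType) (n : nat) (v : 'cV[R]_n) : 0 <= l1norm v.
Proof. exact: sumr_ge0. Qed.

Lemma ler_l1norm (R : realType) (n : nat) (v : 'cV[R]_n) i :
  `|v i ord0| <= l1norm v.
Proof. by rewrite /l1norm (bigD1 i)//= lerDl sumr_ge0. Qed.

Lemma mulmx_l1norm (R : realType) (m n : nat) (M : 'M[R]_(m, n)) (B : R)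
    (v : 'cV[R]_n) i :
  (forall j, `|M i j| <= B) -> `|(M *m v) i ord0| <= B * l1norm v.
Proof.
move=> MB; rewrite mxE (le_trans (ler_norm_sum _ _ _))// mulr_sumr.
by apply: ler_sum => j _; rewrite normrM ler_wpM2r.
Qed.

Lemma poly_mx_bounded (R : realType) (m n : nat) (K : 'M[{poly R}]_(m, n)) (s : R) :
  exists2 B : R, 0 <= B & forall (u : R) i j, 0 <= u <= s -> `|(K i j).[u]| <= B.
Proof.
have H (ij : 'I_m * 'I_n) : exists B, 0 <= B /\
    forall u, 0 <= u <= s -> `|(K ij.1 ij.2).[u]| <= B.
  have [B B0 HB] := acont_bounded (acont_horner (K ij.1 ij.2) (@acont_id _ `[0, s]%classic)).
  by exists B.
have [B /all_and2[B0 HB]] := fin_all_exists H.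
exists (\sum_ij B ij); first exact: sumr_ge0.
move=> u i j us; apply: le_trans (HB (i, j) u us) _.
by rewrite (bigD1 (i, j))//= lerDl sumr_ge0.
Qed.

Lemma le_normr_Rintegral_dominated (R : realType) (D J : set (measurableTypeR R))
    (h k : R -> R) :
  measurable D -> measurable J -> D `<=` J ->
  lebesgue_measure.-integrable J (EFin \o h) ->
  lebesgue_measure.-integrable J (EFin \o k) ->
  (forall t, J t -> `|h t| <= k t) ->
  `|\int[lebesgue_measure]_(t in D) h t| <= \int[lebesgue_measure]_(t in J) k t.
Proof.
move=> mD mJ DJ ih ik hk.
have ihD : lebesgue_measure.-integrable D (EFin \o h) by exact: integrableS ih.
have ikD : lebesgue_measure.-integrable D (EFin \o k) by exact: integrableS ik.
apply: (@le_trans _ _ (\int[lebesgue_measure]_(t in D) `|h t|)).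
  by rewrite (le_normr_Rintegral _ ihD).
apply: (@le_trans _ _ (\int[lebesgue_measure]_(t in D) k t)).
  apply: le_Rintegral => //; first exact: integrable_norm.
  by move=> t /DJ; exact: hk.
apply: fine_le; [exact: integrable_fin_num|exact: integrable_fin_num|].
apply: ge0_subset_integral => //; first by have /measurable_int := ik.
by move=> t /hk; rewrite lee_fin; exact: le_trans.
Qed.

Lemma integrable_sum_fct (R : realType) (J : set (measurableTypeR R)) (n : nat)
    (f : 'I_n -> R -> R) :
  measurable J ->
  (forall i, lebesgue_measure.-integrable J (EFin \o f i)) ->
  lebesgue_measure.-integrable J (EFin \o (fun t => \sum_i f i t)).
Proof.
move=> mJ fi; rewrite (_ : EFin \o _ = (fun t => \sum_i (EFin \o f i) t)%E).
  by apply: integrable_sum.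
by apply/funext => t /=; rewrite sumEFin.
Qed.

Lemma integrable_l1norm (R : realType) (J : set (measurableTypeR R)) (n : nat)
    (f : R -> 'cV[R]_n) :
  measurable J ->
  (forall i, lebesgue_measure.-integrable J (EFin \o (fun t => f t i ord0))) ->
  lebesgue_measure.-integrable J (EFin \o (fun t => l1norm (f t))).
Proof.
move=> mJ fi; apply: (integrable_sum_fct (f := fun i t => `|f t i ord0|)) => // i.
exact: (integrable_norm (fi i)).
Qed.

Lemma integrableD_fct (R : realType) (J : set (measurableTypeR R)) (f g : R -> R) :
  measurable J ->
  lebesgue_measure.-integrable J (EFin \o f) ->
  lebesgue_measure.-integrable J (EFin \o g) ->
  lebesgue_measure.-integrable J (EFin \o (fun t => f t + g t)).
Proof. by move=> mJ fi gi; exact: (integrableD mJ fi gi). Qed.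

Lemma integrableZ_fct (R : realType) (J : set (measurableTypeR R)) (c : R) (f : R -> R) :
  measurable J ->
  lebesgue_measure.-integrable J (EFin \o f) ->
  lebesgue_measure.-integrable J (EFin \o (fun t => c * f t)).
Proof. by move=> mJ fi; exact: (integrableZl mJ c fi). Qed.

(** The order of quantifiers matters: [B] may depend on [s], while the coefficient [alpha] of [|z|]
    is any bound on the entries of [A], whatever [s] is. *)
Lemma kernel_bound (R : realType) (n m : nat) (A : 'M[R]_n) (C : 'M[R]_(m, n)) :
  completely_observable A C ->
  forall s : R, 0 < s -> exists2 B : R, 0 <= B &
    forall alpha : R, (forall i j, `|A i j| <= alpha) ->
    forall (c : R) (f z : R -> 'cV[R]_n),
    (forall i, acont `[c, c + s] (fun t => z t i ord0)) ->
    {ae lebesgue_measure, forall t, c < t < c + s ->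
      is_derive t 1 z (A *m z t + f t)} ->
    (forall i, lebesgue_measure.-integrable `[c, c + s]
      (EFin \o (fun t => f t i ord0))) ->
    forall t i, c <= t <= c + s -> `|z t i ord0| <=
      2 * \int[lebesgue_measure]_(u in `[c, c + s])
        (B * (l1norm (C *m z u) + l1norm (f u)) + alpha * l1norm (z u)).
Proof.
move=> /observable_left_inverse[J [N NE]] s s0.
have [K [L [Psi [KLP K0 Ks Psi01]]]] := kalman_kernel s0 NE.
have [BL BL0 HL] := poly_mx_bounded L s; have [BK BK0 HK] := poly_mx_bounded K s.
have B0 : 0 <= BL + BK + 1 by rewrite !addr_ge0.
(* The extra 1 lets [k] dominate [h] as well, where [f] enters with coefficient 1. *)
exists (BL + BK + 1) => //; set B := BL + BK + 1.
move=> alpha HA c f z az dz fi.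
pose I := `[c, c + s]%classic : set (measurableTypeR R).
have mI : measurable I by exact: measurable_itv.
pose h t := A *m z t + f t.
pose k t := B * (l1norm (C *m z t) + l1norm (f t)) + alpha * l1norm (z t).
have iz i : lebesgue_measure.-integrable I (EFin \o (fun t => z t i ord0)).
  exact: acont_integrable.
have iM p (M : 'M[R]_(p, n)) i :
    lebesgue_measure.-integrable I (EFin \o (fun t => (M *m z t) i ord0)).
  have -> : (fun t => (M *m z t) i ord0) = (fun t => \sum_j M i j * z t j ord0).
    by apply/funext => t; rewrite mxE.
  apply: integrable_sum_fct => // j.
  exact: (@acontM_integrable _ _ _ (fun=> M i j) _ (acont_cst _ _) (iz j)).
have ih i : lebesgue_measure.-integrable I (EFin \o (fun t => h t i ord0)).
  rewrite (_ : (fun t => _) = fun t => (A *m z t) i ord0 + f t i ord0).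
    exact: integrableD_fct (iM _ _ _) (fi i).
  by apply/funext => t; rewrite mxE.
have iG : lebesgue_measure.-integrable I
    (EFin \o (fun t => l1norm (C *m z t) + l1norm (f t))).
  by apply: integrableD_fct => //; apply: integrable_l1norm.
have ik : lebesgue_measure.-integrable I (EFin \o k).
  apply: integrableD_fct => //; first exact: integrableZ_fct.
  by apply: integrableZ_fct => //; exact: integrable_l1norm.
have hk t i : `|h t i ord0| <= k t.
  rewrite mxE (le_trans (ler_normD _ _))// /k addrC; apply: lerD.
    apply: le_trans (ler_l1norm _ _) _.
    apply: (@le_trans _ _ (1 * (l1norm (C *m z t) + l1norm (f t)))).
      by rewrite mul1r lerDr l1norm_ge0.
    by apply: ler_wpM2r; rewrite ?addr_ge0 ?l1norm_ge0// lerDr addr_ge0.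
  exact: mulmx_l1norm.
have end_bound i : `|z (c + s) i ord0| <= \int[lebesgue_measure]_(u in I) k u.
  pose g t := \sum_j (K i j).[t - c] * z t j ord0.
  pose d t := \sum_j ((K i j)^`().[t - c] * z t j ord0 + (K i j).[t - c] * h t j ord0).
  have ac p : acont `[c, c + s] (fun t => p.[t - c]).
    by apply: acont_horner; apply: acontB; [exact: acont_id|exact: acont_cst].
  have ag : acont `[c, c + s] g by apply: acont_sum => j; exact: acontM.
  have dg : {ae lebesgue_measure, forall t, c < t < c + s -> is_derive t 1 g (d t)}.
    apply: filterS dz; first exact: (ae_filter_ringOfSetsType lebesgue_measure).
    by move=> t /[apply]; exact: is_derive_mulmx.
  have id : lebesgue_measure.-integrable I (EFin \o d).
    apply: integrable_sum_fct => // j.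
    apply: integrableD_fct => //; first exact: acontM_integrable (ac _) (iz j).
    exact: acontM_integrable (ac _) (ih j).
  have cs : c <= c + s by rewrite lerDl ltW.
  have := acont_FTC cs ag dg id.
  have -> : g (c + s) - g c = z (c + s) i ord0.
    have -> : g c = 0 by rewrite /g big1// => j _; rewrite subrr K0 mul0r.
    rewrite subr0 /g (bigD1 i)//= big1 ?addr0; last first.
      by move=> j ji; rewrite addrC addKr Ks eq_sym (negbTE ji) mul0r.
    by rewrite addrC addKr Ks eqxx mul1r.
  move=> <-; apply: le_normr_Rintegral_dominated => // t.
  rewrite /I/= in_itv/= => tcs.
  have ts : 0 <= t - c <= s by move: tcs; rewrite subr_ge0 lerBlDl.
  (* Evaluation at [t - c] is a ring morphism, so it carries the identity [KLP] over to real
     matrices. *)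
  pose ev p q := @map_mx _ _ (horner_eval (t - c)) p q.
  have dE : d t = (ev _ _ L *m (C *m z t)) i ord0
      + Psi.[t - c] * (A *m z t) i ord0 + (ev _ _ K *m f t) i ord0.
    have -> : d t = (ev _ _ (map_mx (@deriv R) K) *m z t + ev _ _ K *m h t) i ord0.
      by rewrite !mxE -big_split/=; apply: eq_bigr => j _; rewrite !mxE.
    have evC p q (M : 'M[R]_(p, q)) : ev p q (map_mx polyC M) = M.
      by apply/matrixP => a b; rewrite !mxE /horner_eval hornerC.
    have evKLP : ev _ _ (map_mx (@deriv R) K) + ev _ _ K *m A =
        ev _ _ L *m C + Psi.[t - c] *: A.
      have evM p q r (X : 'M[{poly R}]_(p, q)) (Y : 'M[{poly R}]_(q, r)) :
        ev _ _ (X *m Y) = ev _ _ X *m ev _ _ Y by exact: map_mxM.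
      have evD p q (X Y : 'M[{poly R}]_(p, q)) : ev _ _ (X + Y) = ev _ _ X + ev _ _ Y.
        exact: map_mxD.
      have evZ p q (X : 'M[{poly R}]_(p, q)) : ev _ _ (Psi *: X) = Psi.[t - c] *: ev _ _ X.
        exact: map_mxZ.
      by have := congr1 (ev _ _) KLP; rewrite !evD !evM evZ !evC.
    rewrite /h mulmxDr !mulmxA addrA -mulmxDl evKLP mulmxDl mxE [X in X + _]mxE.
    by rewrite -scalemxAl [X in _ + X + _]mxE.
  have /andP[P0 P1] := Psi01 _ ts.
  have evB p q (M : 'M[{poly R}]_(p, q)) b v a :
      (forall u i j, 0 <= u <= s -> `|(M i j).[u]| <= b) ->
      `|(ev p q M *m v) a ord0| <= b * l1norm v.
    by move=> Mb; apply: mulmx_l1norm => j; rewrite !mxE; exact: Mb.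
  rewrite dE (le_trans (ler_normD _ _))// (le_trans (lerD (ler_normD _ _) (lexx _)))//.
  have h1 := evB _ _ L BL (C *m z t) i HL.
  have h2 := evB _ _ K BK (f t) i HK.
  have h3 : `|Psi.[t - c] * (A *m z t) i ord0| <= alpha * l1norm (z t).
    rewrite normrM ger0_norm// (le_trans (ler_piMl (normr_ge0 _) P1))//.
    exact: mulmx_l1norm.
  have : 0 <= (BK + 1) * l1norm (C *m z t) by rewrite mulr_ge0 ?l1norm_ge0 ?addr_ge0.
  have : 0 <= (BL + 1) * l1norm (f t) by rewrite mulr_ge0 ?l1norm_ge0 ?addr_ge0.
  rewrite /k /B; move: h1 h2 h3.
  move: `|_| `|_| `|_| (l1norm _) (l1norm _) (l1norm _) => x1 x2 x3 y1 y2 y3.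
  lra.
move=> t i tcs; rewrite -/I -/k.
have [ct tc] := andP tcs.
have itI : `[t, c + s]%classic `<=` I.
  by move=> u; rewrite /I/= !in_itv/= => /andP[tu ->]; rewrite (le_trans ct tu).
have dzi : {ae lebesgue_measure, forall u, t < u < c + s ->
    is_derive u (1 : R) (fun u => z u i ord0) (h u i ord0)}.
  apply: filterS dz; first exact: (ae_filter_ringOfSetsType lebesgue_measure).
  move=> u dz /andP[tu uc]; apply: is_derive_mx_coord; apply: dz.
  by rewrite (le_lt_trans ct tu).
have mt : measurable (`[t, c + s]%classic : set (measurableTypeR R)).
  exact: measurable_itv.
(* Going back from the right endpoint to [t] costs a second integral of [k], whence the factor 2. *)
have := acont_FTC tc (acontS itI (az i)) dzi (integrableS mI mt itI (ih i)).
have := le_normr_Rintegral_dominated mt mI itI (ih i) ik (fun t _ => hk t i).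
move=> + E; rewrite E => h1; have h2 := end_bound i.
have -> : z t i ord0 = z (c + s) i ord0 - (z (c + s) i ord0 - z t i ord0) by ring.
rewrite (le_trans (ler_normB _ _))//; move: h1 h2; lra.
Qed.

(** The bound is kept pointwise, not integrated, so that the window around each point of a tile can
    be chosen separately. *)
Lemma local_bound (R : realType) (n m : nat) (A : 'M[R]_n) (C : 'M[R]_(m, n)) :
  completely_observable A C ->
  exists2 s0 : R, 0 < s0 & forall s : R, 0 < s <= s0 -> exists2 B : R, 0 <= B &
    forall (c : R) (f z : R -> 'cV[R]_n),
    (forall i, acont `[c, c + s] (fun t => z t i ord0)) ->
    {ae lebesgue_measure, forall t, c < t < c + s ->
      is_derive t 1 z (A *m z t + f t)} ->
    (forall i, lebesgue_measure.-integrable `[c, c + s]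
      (EFin \o (fun t => f t i ord0))) ->
    forall t, c <= t <= c + s -> l1norm (z t) <=
      B * \int[lebesgue_measure]_(u in `[c, c + s])
        (l1norm (C *m z u) + l1norm (f u)).
Proof.
move=> obs; pose alpha := \sum_i \sum_j `|A i j|.
have alpha0 : 0 <= alpha by apply: sumr_ge0 => i _; apply: sumr_ge0.
have HA i j : `|A i j| <= alpha.
  rewrite /alpha (bigD1 i)//= (bigD1 j)//= -addrA lerDl addr_ge0 ?sumr_ge0//.
  by move=> k _; exact: sumr_ge0.
pose N : R := n%:R * alpha; have N0 : 0 <= N by rewrite mulr_ge0.
(* This threshold makes the coefficient [2 * s * N] of [Z] at most 1/2; the added 1 covers the case
   [N = 0]. *)
exists (4 * (N + 1))^-1; first by rewrite invr_gt0 mulr_gt0 ?ltr_wpDl.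
move=> s /andP[s0 sN].
have sN4 : 4 * s * N <= 1.
  have : s * (4 * (N + 1)) <= 1 by rewrite -ler_pdivlMr ?div1r// mulr_gt0 ?ltr_wpDl.
  by nra.
have [B B0 HB] := kernel_bound obs s0.
exists (2 * n%:R * (B + 4 * alpha * s * n%:R * B)).
  by rewrite !(mulr_ge0, addr_ge0)// ltW.
move=> c f z az dz fi.
have {}HB := HB alpha HA c f z az dz fi.
pose I := `[c, c + s]%classic : set (measurableTypeR R).
have mI : measurable I by exact: measurable_itv.
have iz i : lebesgue_measure.-integrable I (EFin \o (fun t => z t i ord0)).
  exact: acont_integrable.
have iM i : lebesgue_measure.-integrable I (EFin \o (fun t => (C *m z t) i ord0)).
  have -> : (fun t => (C *m z t) i ord0) = (fun t => \sum_j C i j * z t j ord0).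
    by apply/funext => t; rewrite mxE.
  by apply: integrable_sum_fct => // j; exact: integrableZ_fct.
pose G t := l1norm (C *m z t) + l1norm (f t).
have iG : lebesgue_measure.-integrable I (EFin \o G).
  by apply: integrableD_fct => //; apply: integrable_l1norm.
have iz1 := integrable_l1norm mI iz.
pose X := \int[lebesgue_measure]_(u in I) G u.
pose Z := \int[lebesgue_measure]_(u in I) l1norm (z u).
have X0 : 0 <= X by apply: Rintegral_ge0 => t _; rewrite addr_ge0 ?l1norm_ge0.
have Z0 : 0 <= Z by apply: Rintegral_ge0 => t _; rewrite l1norm_ge0.
have QE : \int[lebesgue_measure]_(u in I) (B * G u + alpha * l1norm (z u)) =
    B * X + alpha * Z.
  rewrite RintegralD//; [|exact: integrableZ_fct|exact: integrableZ_fct].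
  by rewrite !RintegralZl.
have zt t : c <= t <= c + s -> l1norm (z t) <= n%:R * (2 * (B * X + alpha * Z)).
  move=> tI; rewrite -[n in n%:R]card_ord -sum1_card natr_sum mulr_suml.
  by apply: ler_sum => i _; rewrite mul1r -QE; exact: HB.
have ZX : Z <= s * (n%:R * (2 * (B * X + alpha * Z))).
  apply: (@le_trans _ _ (\int[lebesgue_measure]_(u in I)
      (n%:R * (2 * (B * X + alpha * Z))))).
    apply: le_Rintegral => //.
    by apply: acont_integrable; exact: acont_cst.
  rewrite Rintegral_cst// [X in fine X]lebesgue_measure_itv/= lte_fin ltrDl s0/=.
  by rewrite addrAC subrr add0r mulrC.
(* For [s] small the [Z] on the right-hand side is absorbed. *)
have {}ZX : Z <= 4 * s * n%:R * B * X.
  have : s * (n%:R * (2 * (B * X + alpha * Z))) =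
    2 * s * n%:R * B * X + 2 * s * N * Z by rewrite /N; ring.
  have : 4 * s * N * Z <= Z by rewrite ler_piMl.
  by move: ZX; lra.
move=> t tI; apply: le_trans (zt t tI) _; rewrite -/I -/G -/X.
have : alpha * Z <= alpha * (4 * s * n%:R * B * X) by rewrite ler_wpM2l.
have := ler0n R n; nra.
Qed.

(** * Tiling *)

Lemma acont_measurable_fun (R : realType) (I : set (measurableTypeR R)) (f : R -> R) :
  measurable I -> acont I f -> measurable_fun I f.
Proof. by move=> mI /acont_continuous; exact: subspace_continuous_measurable_fun. Qed.

Lemma measurable_l1norm d (T : measurableType d) (R : realType) (n : nat)
    (D : set T) (f : T -> 'cV[R]_n) :
  (forall i, measurable_fun D (fun t => f t i ord0)) ->
  measurable_fun D (fun t => l1norm (f t)).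
Proof.
by move=> mf; apply: measurable_sum => i; exact: measurableT_comp (mf i).
Qed.

Lemma measurable_mulmx d (T : measurableType d) (R : realType) (m n : nat)
    (D : set T) (M : 'M[R]_(m, n)) (f : T -> 'cV[R]_n) i :
  (forall j, measurable_fun D (fun t => f t j ord0)) ->
  measurable_fun D (fun t => (M *m f t) i ord0).
Proof.
move=> mf; rewrite (_ : (fun t => _) = fun t => \sum_j M i j * f t j ord0).
  by apply: measurable_sum => j; apply: measurable_funM.
by apply/funext => t; rewrite mxE.
Qed.

(** Two adjacent open tiles miss only the point [y], which is null. Nonnegative extended integrals
    avoid any integrability condition. *)
Lemma integral_oo_split (R : realType) (x y w : R) (g : R -> \bar R) :
  x <= y -> y < w -> measurable_fun (`]x, w[%classic : set (measurableTypeR R)) g ->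
  (forall t, (0 <= g t)%E) ->
  (\int[lebesgue_measure]_(t in `]x, w[) g t =
   \int[lebesgue_measure]_(t in `]x, y[) g t +
   \int[lebesgue_measure]_(t in `]y, w[) g t)%E.
Proof.
move=> xy yw mg g0.
have sub1 : `]x, y]%classic `<=` `]x, w[%classic.
  by move=> t /=; rewrite !in_itv/= => /andP[-> ty]; rewrite (le_lt_trans ty).
have UE : `]x, w[%classic = `]x, y]%classic `|` `]y, w[%classic :> set R.
  apply/seteqP; split => [t|t [/sub1//|]] /=; rewrite !in_itv/=.
    by move=> /andP[xt tw]; case: (leP t y) => ty; [left|right]; apply/andP.
  by move=> /andP[yt ->]; rewrite (le_lt_trans xy).
rewrite [X in _ = (X + _)%E]integral_itv_bndo_bndc; last first.
  apply: measurable_funS mg; first exact: measurable_itv.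
  by apply: subset_trans sub1; exact: subset_itv_oo_oc.
rewrite UE in mg *; rewrite ge0_integral_setU//; try exact: measurable_itv.
apply/disj_setPS => t [/=]; rewrite !in_itv/= => /andP[_ ty] /andP[yt _].
by move: (lt_le_trans yt ty); rewrite ltxx.
Qed.

Lemma tiling_bound (R : realType) (a d : R) (F G : R -> \bar R) (c : R) (M : nat) :
  0 < d ->
  measurable_fun (`]a, a + d *+ M[%classic : set (measurableTypeR R)) F ->
  measurable_fun (`]a, a + d *+ M[%classic : set (measurableTypeR R)) G ->
  (forall t, (0 <= F t)%E) -> (forall t, (0 <= G t)%E) ->
  (forall j, (j < M)%N ->
    (\int[lebesgue_measure]_(t in `](a + d *+ j)%R, (a + d *+ j.+1)%R[) F t <=
     c%:E * \int[lebesgue_measure]_(t in `](a + d *+ j)%R, (a + d *+ j.+1)%R[) G t)%E) ->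
  (\int[lebesgue_measure]_(t in `]a, (a + d *+ M)%R[) F t <=
   c%:E * \int[lebesgue_measure]_(t in `]a, (a + d *+ M)%R[) G t)%E.
Proof.
move=> d0 + + F0 G0; elim: M => [|M ih] mF mG H.
  by rewrite mulr0n addr0 set_itvoo0 !integral_set0 mule0.
have aM : a <= a + d *+ M by rewrite lerDl mulrn_wge0// ltW.
have MM : a + d *+ M < a + d *+ M.+1 by rewrite ltrD2l mulrS ltrDr.
have sub : `]a, a + d *+ M[%classic `<=` `]a, a + d *+ M.+1[%classic.
  by move=> t /=; rewrite !in_itv/= => /andP[-> tM]; rewrite (lt_trans tM).
rewrite !(@integral_oo_split _ a (a + d *+ M) (a + d *+ M.+1))// muleDr//; last first.
  by rewrite ge0_adde_def// inE integral_ge0.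
apply: leeD; last exact: H.
apply: ih => [||j jM]; last exact: H (ltnW jM).
- by apply: measurable_funS mF => //; exact: measurable_itv.
- by apply: measurable_funS mG => //; exact: measurable_itv.
Qed.

Lemma lebesgue_observability (R : realType) (n m : nat) (A : 'M[R]_n) (C : 'M[R]_(m, n)) :
  completely_observable A C ->
  exists2 B : R, 0 <= B &
    forall (a : R) (k : nat) (f z : R -> 'cV[R]_n),
    (forall i, acont `]a, a + k%:R[ (fun t => z t i ord0)) ->
    {ae lebesgue_measure, forall t, a < t < a + k%:R ->
      is_derive t 1 z (A *m z t + f t)} ->
    (forall i, lebesgue_measure.-integrable `]a, a + k%:R[
      (EFin \o (fun t => f t i ord0))) ->
    (\int[lebesgue_measure]_(t in `]a, (a + k%:R)%R[) (l1norm (z t))%:E <=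
     B%:E * \int[lebesgue_measure]_(t in `]a, (a + k%:R)%R[)
       (l1norm (C *m z t) + l1norm (f t))%:E)%E.
Proof.
move=> /local_bound[s0 s00 Hs0].
(* A tile length of the form [1 / N] divides every integer length exactly. A third of it leaves room
   for a closed window around any point of an open tile. *)
pose N := (Num.Def.archi_bound s0^-1).+1; pose d : R := N%:R^-1; pose s := d / 3.
have d0 : 0 < d by rewrite invr_gt0 ltr0n.
have s_gt0 : 0 < s by rewrite divr_gt0.
have ds : d = 3 * s by rewrite /s mulrC mulfVK.
have ss0 : s <= s0.
  have : d <= s0.
    rewrite /d invf_ple ?posrE ?ltr0n//; apply: ltW.
    apply: lt_trans (archi_boundP _) _; first by rewrite invr_ge0 ltW.
    by rewrite ltr_nat ltnS.
  by move: s_gt0; rewrite ds; lra.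
have [|B B0 HB] := Hs0 s; first by rewrite s_gt0.
(* The factor [d] comes from integrating a constant bound over a tile of length [d]. *)
exists (B * d); first by rewrite mulr_ge0// ltW.
move=> a k f z az dz fi; pose b := a + k%:R.
have bE : b = a + d *+ (k * N).
  by rewrite /b mulnC mulrnA -[_ *+ N]mulr_natr mulVf// pnatr_eq0.
pose I := `]a, b[%classic : set (measurableTypeR R).
have mI : measurable I by exact: measurable_itv.
have mz i : measurable_fun I (fun t => z t i ord0) by exact: acont_measurable_fun.
have mf i : measurable_fun I (fun t => f t i ord0).
  by have /measurable_int/measurable_EFinP := fi i.
have mlz : measurable_fun I (fun t => (l1norm (z t))%:E).
  by apply/measurable_EFinP; exact: measurable_l1norm.
have mG : measurable_fun I (fun t => (l1norm (C *m z t) + l1norm (f t))%:E).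
  apply/measurable_EFinP/measurable_funD; last exact: measurable_l1norm.
  by apply: measurable_l1norm => i; exact: measurable_mulmx.
rewrite -/b bE; apply: tiling_bound; rewrite -?bE//.
- by move=> t; rewrite lee_fin l1norm_ge0.
- by move=> t; rewrite lee_fin addr_ge0 ?l1norm_ge0.
move=> j jM; set x := a + d *+ j; set y := a + d *+ j.+1.
have xy : y = x + d by rewrite /y mulrSr addrA.
have ax : a <= x by rewrite lerDl mulrn_wge0// ltW.
have yb : y <= b by rewrite bE lerD2l ler_wpMn2l// ltW.
pose P := `]x, y[%classic : set (measurableTypeR R).
have mP : measurable P by exact: measurable_itv.
have PI : P `<=` I.
  move=> t; rewrite /P /I/= !in_itv/= => /andP[xt ty].
  by rewrite (le_lt_trans ax xt) (lt_le_trans ty yb).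
(* Every [t] in a tile lies in a closed interval of a third of its length
   contained in the tile: [z] may be discontinuous at the endpoints of [I]. *)
have pointwise t : P t -> ((l1norm (z t))%:E <= B%:E *
    \int[lebesgue_measure]_(t in P) (l1norm (C *m z t) + l1norm (f t))%:E)%E.
  rewrite /P/= in_itv/= => /andP[xt ty].
  have [c [cx cy ct tc]] : exists c, [/\ x < c, c + s < y, c <= t & t <= c + s].
    (* The window ends at [t] if there is room on its left; otherwise it starts at [t] and ends by
       [x + 2 * s], before [y = x + 3 * s]. *)
    have [xs|xs] := ltP (x + s) t.
      by exists (t - s); split; move: xs ty; lra.
    by exists t; split; move: xs s_gt0 xt; rewrite ?xy ?ds; lra.
  pose J := `[c, c + s]%classic : set (measurableTypeR R).
  have mJ : measurable J by exact: measurable_itv.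
  have JP : J `<=` P.
    move=> u; rewrite /J /P/= !in_itv/= => /andP[cu uc].
    by rewrite (lt_le_trans cx cu) (le_lt_trans uc cy).
  have JI : J `<=` I := subset_trans JP PI.
  have azJ i : acont J (fun t => z t i ord0) := acontS JI (az i).
  have fiJ i : lebesgue_measure.-integrable J (EFin \o (fun t => f t i ord0)).
    exact: integrableS (fi i).
  have dzJ : {ae lebesgue_measure, forall t, c < t < c + s ->
      is_derive t 1 z (A *m z t + f t)}.
    apply: filterS dz; first exact: (ae_filter_ringOfSetsType lebesgue_measure).
    move=> u dz /andP[cu uc]; apply: dz.
    have : J u by rewrite /J/= in_itv/= !ltW.
    by move=> /JI; rewrite /I/= in_itv.
  have := HB c f z azJ dzJ fiJ t; rewrite ct tc => /(_ isT) h.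
  apply: (@le_trans _ _ (B%:E * \int[lebesgue_measure]_(u in J)
      (l1norm (C *m z u) + l1norm (f u))%:E)%E).
    rewrite -[X in (_ * X)%E]fineK; first by rewrite -EFinM lee_fin.
    apply: integrable_fin_num => //; apply: integrableD_fct => //.
      apply: integrable_l1norm => // i.
      have -> : (fun t => (C *m z t) i ord0) = (fun t => \sum_j C i j * z t j ord0).
        by apply/funext => u; rewrite mxE.
      apply: integrable_sum_fct => // l; apply: integrableZ_fct => //.
      exact: acont_integrable.
    exact: integrable_l1norm.
  apply: lee_wpmul2l; first by rewrite lee_fin.
  apply: ge0_subset_integral => //; first exact: measurable_funS mG.
  by move=> u _; rewrite lee_fin addr_ge0 ?l1norm_ge0.
pose V := (B%:E *
  \int[lebesgue_measure]_(t in P) (l1norm (C *m z t) + l1norm (f t))%:E)%E.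
apply: (@le_trans _ _ (\int[lebesgue_measure]_(t in P) cst V t)%E).
  apply: ge0_le_integral => //.
  - by move=> t _; rewrite lee_fin l1norm_ge0.
  - exact: measurable_funS mlz.
rewrite integral_cst// [X in (_ * X)%E]lebesgue_measure_itv/= lte_fin xy ltrDl d0.
by rewrite -EFinD addrAC subrr add0r /V muleAC -EFinM /P xy.
Qed.

(** * Transfer to the completed Lebesgue measure *)

Notation completedR R := (caratheodory_type ((wlength (@idfun R))^*)%mu).

Lemma completed_measurable (R : realType) (A : set R) :
  measurable (A : set (measurableTypeR R)) -> measurable (A : set (completedR R)).
Proof. by move=> mA; apply: sub_caratheodory. Qed.

Lemma completed_measurable_fun d (T : measurableType d) (R : realType) (D : set R)
    (g : R -> T) :
  measurable_fun (D : set (measurableTypeR R)) g ->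
  measurable (D : set (measurableTypeR R)) ->
  measurable_fun (D : set (completedR R)) g.
Proof. by move=> mg mD _ Y mY; apply: completed_measurable; exact: mg. Qed.

(** The identity is measurable from the completed space to the Borel one and pushes the completed
    measure forward to [lebesgue_measure]. *)
Lemma ge0_integral_completed (R : realType) (D : set R) (g : R -> \bar R) :
  measurable (D : set (measurableTypeR R)) ->
  measurable_fun (D : set (measurableTypeR R)) g ->
  (forall t, (0 <= g t)%E) ->
  (\int[completed_lebesgue_measure]_(t in D) g t =
   \int[lebesgue_measure]_(t in D) g t)%E.
Proof.
move=> mD mg g0.
have mid : measurable_fun setT (id : completedR R -> measurableTypeR R).
  by move=> _ Y mY; rewrite setTI; exact: completed_measurable.
have := @ge0_integral_pushforward _ _ _ _ R _ mid completed_lebesgue_measure D g mD mg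
  (fun t _ => g0 t).
move=> h.
transitivity (\int[completed_lebesgue_measure]_(t in id @^-1` D) (g \o id) t)%E => //.
Qed.

Lemma completed_measurable_split (R : realType) (E : set R) :
  measurable (E : set (completedR R)) -> exists A N : set R,
    [/\ measurable (A : set (measurableTypeR R)),
        (@lebesgue_measure R).-negligible N & E = A `|` N].
Proof.
rewrite -completed_caratheodory_measurable g_sigma_completed_algebra_genE.
by move=> [A mA [N nN <-]]; exists A, N.
Qed.

Lemma completed_negligible (R : realType) (N : set R) :
  (@completed_lebesgue_measure R).-negligible N -> (@lebesgue_measure R).-negligible N.
Proof.
move=> [E [/completed_measurable_split[A [M [mA nM EE]]] E0 NE]].
have [F [mF F0 AMF]] : (@lebesgue_measure R).-negligible (A `|` M).
  apply: negligibleU => //; apply/negligibleP => //.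
  apply/eqP; rewrite eq_le measure_ge0 andbT -[leRHS]E0 EE.
  by apply: le_outer_measure; exact: subsetUl.
by exists F; split => //; apply: subset_trans AMF; rewrite -EE.
Qed.

Lemma completed_ae (R : realType) (P : R -> Prop) :
  {ae completed_lebesgue_measure, forall t : R, P t} ->
  {ae lebesgue_measure, forall t : R, P t}.
Proof. exact: completed_negligible. Qed.

(** The preimages of the countably many rational rays differ from Borel sets by negligible ones.
    Setting [g] to 0 on a Borel null set covering all these defects makes it Borel. *)
Lemma borel_version (R : realType) (D : set R) (g : R -> R) :
  measurable (D : set (measurableTypeR R)) ->
  measurable_fun (D : set (completedR R)) g ->
  exists (h : R -> R) (N : set R),
    [/\ measurable_fun (D : set (measurableTypeR R)) h,
        measurable (N : set (measurableTypeR R)), lebesgue_measure N = 0 &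
        forall t, ~ N t -> h t = g t].
Proof.
move=> mD mg.
pose E (q : rat) := D `&` g @^-1` `]-oo, ratr q[%classic.
have mE q : measurable (E q : set (completedR R)).
  apply: mg; first exact: completed_measurable.
  exact: measurable_itv.
have /choice[A /choice[N AN]] q := completed_measurable_split (mE q).
have /choice[B nB] q : exists B : set R,
    [/\ measurable (B : set (measurableTypeR R)), lebesgue_measure B = 0 & N q `<=` B].
  by have [_ [B ?] _] := AN q; exists B.
have [e eP] : exists e : nat -> option rat, forall q, exists n, e n = Some q.
  by exists unpickle => q; exists (pickle q); exact: pickleK.
pose M := \bigcup_n (if e n is Some q then B q else set0).
have BM q : B q `<=` M.
  by move=> t Bt; have [n enq] := eP q; exists n; rewrite ?enq.
have mM : measurable (M : set (measurableTypeR R)).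
  apply: bigcupT_measurable => n; case: (e n) => // q.
  by have [] := nB q.
exists (fun t => if t \in M then 0 else g t), M; split => //.
- apply: (measurability _ (RGenInftyO.measurableE R)) => _ [_ [r ->] <-].
  (* On [M] the new function is 0, hence below [r] exactly when [0 < r]; off [M] a rational between
     the value and [r] selects one of the Borel sets [A q]. *)
  rewrite (_ : _ `&` _ = (if 0 < r then D `&` M else set0) `|`
      \bigcup_q (if ratr q < r then A q `\` M else set0)); last first.
    apply/seteqP; split => [t [Dt]|t [|]].
    + rewrite /= in_itv/=; case: ifPn => [tM -> |tM gr].
        by left; split => //; exact: set_mem.
      right; have [q] := rat_in_itvoo gr; rewrite in_itv/= => /andP[gq qr].
      exists q => //; rewrite qr; split; last by move=> /mem_set; rewrite (negbTE tM).
      have [_ nN EE] := AN q.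
      have : E q t by split => //=; rewrite in_itv.
      rewrite EE => -[//|Nt]; exfalso; move: tM; rewrite notin_setE; apply.
      by apply: (BM q); have [_ _] := nB q; apply.
    + case: ifPn => // r0 [Dt Mt]; split => //=.
      by rewrite in_itv/= mem_set.
    + move=> [q _]; case: ifPn => // qr [At nMt].
      have [_ _ EE] := AN q.
      have [Dt] : E q t by rewrite EE; left.
      rewrite /= !in_itv/= => gq; split => //=.
      by rewrite memNset// (lt_trans gq).
  apply: measurableU; first by case: ifPn => // _; exact: measurableI.
  apply: bigcupT_measurable_rat => q; case: ifPn => // _.
  by apply: measurableD => //; have [] := AN q.
- apply/negligibleP => //; apply: negligible_bigcup => n.
  case: (e n) => [q|]; last exact: negligible_set0.
  by have [mB B0 _] := nB q; apply/negligibleP.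
- by move=> t nMt; rewrite memNset.
Qed.

Lemma ler_enorm (R : realType) (n : nat) (v : 'cV[R]_n) i : `|v i ord0| <= enorm v.
Proof.
rewrite -sqrtr_sqr ler_sqrt; last by apply: sumr_ge0 => j _; exact: sqr_ge0.
by rewrite (bigD1 i)//= lerDl sumr_ge0// => j _; exact: sqr_ge0.
Qed.

Lemma l1norm_le_enorm (R : realType) (n : nat) (v : 'cV[R]_n) :
  l1norm v <= n%:R * enorm v.
Proof.
rewrite -[n in n%:R]card_ord -sum1_card natr_sum mulr_suml.
by apply: ler_sum => i _; rewrite mul1r ler_enorm.
Qed.

Lemma enorm_le_l1norm (R : realType) (n : nat) (v : 'cV[R]_n) :
  enorm v <= l1norm v.
Proof.
rewrite -[leRHS](ger0_norm (l1norm_ge0 v)) -sqrtr_sqr ler_sqrt ?sqr_ge0//.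
rewrite expr2 {1}/l1norm mulr_suml; apply: ler_sum => i _.
by rewrite -real_normK ?num_real// expr2 ler_wpM2l// ler_l1norm.
Qed.

Lemma enorm_ge0 (R : realType) (n : nat) (v : 'cV[R]_n) : 0 <= enorm v.
Proof. exact: sqrtr_ge0. Qed.

Lemma measurable_enorm d (T : measurableType d) (R : realType) (n : nat)
    (D : set T) (f : T -> 'cV[R]_n) :
  (forall i, measurable_fun D (fun t => f t i ord0)) ->
  measurable_fun D (fun t => enorm (f t)).
Proof.
move=> mf.
have ms : measurable_fun setT (@Num.sqrt R).
  by apply: continuous_measurable_fun; exact: sqrt_continuous.
apply: (measurableT_comp ms); apply: measurable_sum => i.
exact: measurable_funX.
Qed.

Lemma abs_continuous_coord (R : realType) (n : nat) (I : set R) (z : R -> 'cV[R]_n) i :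
  abs_continuous I z -> acont I (fun t => z t i ord0).
Proof.
move=> az e /az[d d0 H]; exists d => // N a b abI tI /(H _ _ _ abI tI).
apply: le_lt_trans; apply: ler_sum => k _.
by have := ler_enorm (z (b k) - z (a k)) i; rewrite !mxE.
Qed.

(** The endpoints are null, so all four kinds of bounded interval reduce to the open one that is
    tiled. *)
Lemma integral_itv_oo (R : realType) (a b : R) (bl br : bool) (g : R -> \bar R) :
  let I := [set` Interval (BSide bl a) (BSide br b)] in
  measurable_fun (I : set (completedR R)) g -> (forall t, (0 <= g t)%E) ->
  (\int[completed_lebesgue_measure]_(t in I) g t =
   \int[completed_lebesgue_measure]_(t in `]a, b[) g t)%E.
Proof.
move=> I mg g0.
pose N := [set a] `|` [set b] : set (measurableTypeR R).
have mN : measurable N by exact: measurableU.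
have N0 : lebesgue_measure N = 0%E.
  apply/negligibleP => //.
  by apply: negligibleU; apply/negligibleP => //; exact: lebesgue_measure_set1.
have mI : measurable (I : set (measurableTypeR R)).
  exact: measurable_itv.
have -> := @ge0_negligible_integral _ _ _ completed_lebesgue_measure I N g
  (completed_measurable mN) (completed_measurable mI) mg (fun t _ => g0 t) N0.
congr (integral _ _ _); apply/seteqP; split => t; rewrite /I/= !in_itv/=.
  move=> [/andP[t1 t2] /not_orP[ta tb]].
  have {}ta : t != a by apply/eqP.
  have {}tb : t != b by apply/eqP.
  by rewrite !lt_neqAle eq_sym ta tb (lteifW t1) (lteifW t2).
move=> /andP[ta tb]; split.
  by case: (bl); case: (br) => /=; rewrite ?ta ?tb ?ltW.
by move=> [tE|tE]; move: ta tb; rewrite tE ltxx.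
Qed.

Theorem theorem1 (R : realType) (n m : nat) (A : 'M[R]_n) (C : 'M[R]_(m, n)) :
  completely_observable A C ->
  exists c : R,
    forall (a : R) (k : nat) (bl br : bool) (I : set R) (f z : R -> 'cV[R]_n),
      (0 < k)%N ->
      I = [set` Interval (BSide bl a) (BSide br (a + k%:R))] ->
      vintegrable I f ->
      forced_solution A I f z ->
      (\int[completed_lebesgue_measure]_(t in I) (enorm (z t))%:E <=
        c%:E *
        (\int[completed_lebesgue_measure]_(t in I) (enorm (C *m z t))%:E +
         \int[completed_lebesgue_measure]_(t in I) (enorm (f t))%:E))%E.
Proof.
move=> /lebesgue_observability[B B0 HB].
(* Passing from [l1norm] to [enorm] costs [m] for the observation and [n] for the forcing; their sum
   serves both. *)
exists (B * (m%:R + n%:R)) => a k bl br I f z _ IE fI [az dz].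
pose b := a + k%:R; pose P := `]a, b[%classic : set (measurableTypeR R).
have mP : measurable P by exact: measurable_itv.
have mI : measurable (I : set (measurableTypeR R)) by rewrite IE; exact: measurable_itv.
have PI : P `<=` I.
  rewrite IE => t; rewrite /P/= !in_itv/= => /andP[ta tb].
  by case: (bl); case: (br) => /=; rewrite ?ta ?tb ?ltW.
have azI i : acont I (fun t => z t i ord0) by exact: abs_continuous_coord.
have mz i : measurable_fun (I : set (measurableTypeR R)) (fun t => z t i ord0).
  exact: acont_measurable_fun.
have mfI i : measurable_fun (I : set (completedR R)) (fun t => f t i ord0).
  by have /measurable_int/measurable_EFinP := fI i.
have mfP i : measurable_fun (P : set (completedR R)) (fun t => f t i ord0).
  by apply: measurable_funS (mfI i) => //; exact: completed_measurable.
(* Replacing [f] by the Borel function [fb], equal to it almost everywhere on [P], preserves both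
   the equation and the integrals. *)
have /choice[h /choice[N hN]] i := borel_version mP (mfP i).
have mh i : measurable_fun P (h i) by have [] := hN i.
pose fb t : 'cV[R]_n := \col_i h i t.
have fbE i : (fun t => fb t i ord0) = h i by apply/funext => t; rewrite mxE.
have aeh i : {ae completed_lebesgue_measure, forall t : R, h i t = f t i ord0}.
  have [_ mN N0 hNf] := hN i.
  exists (N i); split => //; first exact: completed_measurable.
  by move=> t /=; apply: contra_notP => /hNf.
have aef : {ae completed_lebesgue_measure, forall t : R, fb t = f t}.
  have : {ae completed_lebesgue_measure, forall t : R, forall i, h i t = f t i ord0}.
    exact: filter_forall.
  apply: filterS; first exact: (ae_filter_ringOfSetsType completed_lebesgue_measure).
  by move=> t ht; apply/colP => i; rewrite mxE ht.
have ih i : lebesgue_measure.-integrable P (EFin \o (fun t => fb t i ord0)).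
  rewrite fbE; apply/integrableP; split; first exact/measurable_EFinP.
  have : completed_lebesgue_measure.-integrable (P : set (completedR R))
      (fun t => (f t i ord0)%:E).
    apply: integrableS (fI i) => //; exact: completed_measurable.
  move=> /integrableP[_]; apply: le_lt_trans.
  rewrite -ge0_integral_completed//; last first.
    by apply/measurable_EFinP; exact: measurableT_comp.
  rewrite le_eqVlt; apply/orP; left; apply/eqP.
  apply: ge0_ae_eq_integral => //.
  - exact: completed_measurable.
  - apply: completed_measurable_fun => //.
    by apply/measurable_EFinP; exact: measurableT_comp.
  - by apply/measurable_EFinP; exact: measurableT_comp.
  - apply: filterS (aeh i); first exact: (ae_filter_ringOfSetsType completed_lebesgue_measure).
    by move=> t /= ht _; rewrite ht.
have dzb : {ae lebesgue_measure, forall t, a < t < a + k%:R ->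
    is_derive t 1 z (A *m z t + fb t)}.
  apply: completed_ae; apply: filterS2 dz aef.
    exact: (ae_filter_ringOfSetsType completed_lebesgue_measure).
  move=> t dzt -> tab; apply: dzt; apply: PI.
  by rewrite /P/= in_itv.
have azP i : acont P (fun t => z t i ord0) := acontS PI (azI i).
have {HB} := HB a k fb z azP dzb ih; rewrite -/b -/P => HB.
have mCz i : measurable_fun (I : set (measurableTypeR R)) (fun t => (C *m z t) i ord0).
  exact: measurable_mulmx.
have mez : measurable_fun (I : set (measurableTypeR R)) (fun t => (enorm (z t))%:E).
  by apply/measurable_EFinP; exact: measurable_enorm.
have meCz : measurable_fun (I : set (measurableTypeR R)) (fun t => (enorm (C *m z t))%:E).
  by apply/measurable_EFinP; exact: measurable_enorm.
have mfb i : measurable_fun P (fun t => fb t i ord0) by rewrite fbE.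
have mefb : measurable_fun P (fun t => (enorm (fb t))%:E).
  by apply/measurable_EFinP; exact: measurable_enorm.
have mef : measurable_fun (I : set (completedR R)) (fun t => (enorm (f t))%:E).
  by apply/measurable_EFinP; exact: measurable_enorm.
have mS (g : R -> \bar R) : measurable_fun (I : set (measurableTypeR R)) g ->
    measurable_fun P g by move=> mg; exact: measurable_funS mg.
(* This applies to [z] and [C z], whose norms are Borel on [I] by continuity of [z] there; only [f]
   needs a Borel version. *)
have to_lebesgue (g : R -> \bar R) :
    measurable_fun (I : set (measurableTypeR R)) g -> (forall t, (0 <= g t)%E) ->
    (\int[completed_lebesgue_measure]_(t in I) g t =
     \int[lebesgue_measure]_(t in P) g t)%E.
  move=> mg g0; have mgc := completed_measurable_fun mg mI.
  have PE : (\int[completed_lebesgue_measure]_(t in I) g t =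
      \int[completed_lebesgue_measure]_(t in P) g t)%E.
    by move: mgc; rewrite IE => mgc; exact: integral_itv_oo.
  by rewrite PE ge0_integral_completed//; exact: mS.
have fE : (\int[completed_lebesgue_measure]_(t in I) (enorm (f t))%:E =
    \int[lebesgue_measure]_(t in P) (enorm (fb t))%:E)%E.
  rewrite -ge0_integral_completed//; last by move=> t; rewrite lee_fin enorm_ge0.
  have -> : (\int[completed_lebesgue_measure]_(t in I) (enorm (f t))%:E =
      \int[completed_lebesgue_measure]_(t in P) (enorm (f t))%:E)%E.
    move: mef; rewrite IE => mef; apply: integral_itv_oo => // t.
    by rewrite lee_fin enorm_ge0.
  apply: ge0_ae_eq_integral => //.
  - exact: completed_measurable.
  - by apply: measurable_funS mef => //; exact: completed_measurable.
  - exact: completed_measurable_fun.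
  - by move=> t _; rewrite lee_fin enorm_ge0.
  - by move=> t _; rewrite lee_fin enorm_ge0.
  - apply: filterS aef; first exact: (ae_filter_ringOfSetsType completed_lebesgue_measure).
    by move=> t /= ht _; rewrite ht.
rewrite fE !to_lebesgue//; last 2 first.
- by move=> t; rewrite lee_fin enorm_ge0.
- by move=> t; rewrite lee_fin enorm_ge0.
have mlz : measurable_fun P (fun t => (l1norm (z t))%:E).
  by apply: mS; apply/measurable_EFinP; exact: measurable_l1norm.
have mG : measurable_fun P (fun t => (l1norm (C *m z t) + l1norm (fb t))%:E).
  apply/measurable_EFinP/measurable_funD; last exact: measurable_l1norm.
  by apply/measurable_EFinP; apply: mS; apply/measurable_EFinP; exact: measurable_l1norm.
have mE : measurable_fun P (fun t => (enorm (C *m z t) + enorm (fb t))%:E).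
  apply/measurable_EFinP/measurable_funD; last exact: measurable_enorm.
  by apply/measurable_EFinP; exact: mS.
apply: (@le_trans _ _ (\int[lebesgue_measure]_(t in P) (l1norm (z t))%:E)%E).
  apply: ge0_le_integral => //.
  - by move=> t _; rewrite lee_fin enorm_ge0.
  - exact: mS.
  - by move=> t _; rewrite lee_fin enorm_le_l1norm.
apply: le_trans HB _; rewrite EFinM -muleA; apply: lee_wpmul2l; first by rewrite lee_fin.
have -> : (\int[lebesgue_measure]_(t in P) (enorm (C *m z t))%:E +
    \int[lebesgue_measure]_(t in P) (enorm (fb t))%:E =
    \int[lebesgue_measure]_(t in P) (enorm (C *m z t) + enorm (fb t))%:E)%E.
  under [RHS]eq_integral do rewrite EFinD.
  rewrite ge0_integralD//; first by move=> t _; rewrite lee_fin enorm_ge0.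
  - exact: mS.
  - by move=> t _; rewrite lee_fin enorm_ge0.
rewrite -ge0_integralZl//; last first.
  by move=> t _; rewrite lee_fin addr_ge0 ?enorm_ge0.
apply: ge0_le_integral => //.
- by move=> t _; rewrite lee_fin addr_ge0 ?l1norm_ge0.
- exact: measurable_funeM.
- move=> t _; rewrite -EFinM lee_fin.
  have h1 := l1norm_le_enorm (C *m z t); have h2 := l1norm_le_enorm (fb t).
  have := enorm_ge0 (C *m z t); have := enorm_ge0 (fb t).
  have := ler0n R m; have := ler0n R n; nra.
Qed.
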